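(* Let $A$ be a Banach subalgebra of $\mathcal{M}^+$ (with the induced norm, and containing the unit $\delta$ of $\mathcal{M}^+$) such that for all $\mu\in A$ and all $t\in[0,1]$, $\mu_t\in A$. Then for all $n\in\mathbb{N}$, $\mathrm{SL}_n(A)=\mathrm{E}_n(A)$.
   Context: $\mathbb{N}=\{1,2,3,\dots\}$. $\mathcal{M}^+$ is the set of all complex Borel measures on $\mathbb{R}$ with support contained in $[0,+\infty)$, with the usual addition and scalar multiplication, with convolution $\ast$ as multiplication, and with the total variation norm $\|\mu\|=|\mu|([0,+\infty))$; it is a commutative unital complex Banach algebra whose unit is the Dirac measure $\delta$ at $0$. A Banach subalgebra with the induced norm is a norm-closed complex subalgebra. For $\mu\in\mathcal{M}^+$ and $t\in[0,1)$, $\mu_t\in\mathcal{M}^+$ is defined by $\mu_t(E):=\int_E(1-t)^x\,d\mu(x)$ for all Borel sets $E\subset[0,+\infty)$. For $t=1$, $\mu_1:=\mu(\{0\})\,\delta$. For a commutative unital ring $R$ and $n\in\mathbb{N}$, $\mathrm{SL}_n(R)$ is the group of $n\times n$ matrices over $R$ with determinant $1$. An elementary matrix is a matrix $I_n+\alpha\,\mathbf{e}_{ij}$ with $i\neq j$, $\alpha\in R$, where $\mathbf{e}_{ij}$ has entry $1$ in position $(i,j)$ and zeros elsewhere. $\mathrm{E}_n(R)$ is the subgroup of $\mathrm{SL}_n(R)$ generated by the elementary matrices. *)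

(* Defs.v *)
From HB Require Import structures.
From mathcomp Require Import all_boot all_order all_algebra.
From mathcomp Require Import all_classical all_reals all_analysis.
From mathcomp Require Import measurable_realfun complex ring.

Set Implicit Arguments.
Unset Strict Implicit.
Unset Printing Implicit Defensive.

Import Order.TTheory GRing.Theory Num.Theory numFieldNormedType.Exports.

Local Open Scope classical_set_scope.
Local Open Scope ring_scope.

Section ComplexLimits.
Variable R : realType.
Implicit Types (z : R[i]) (u : nat -> R[i]).

Lemma ReD z1 z2 : complex.Re (z1 + z2) = complex.Re z1 + complex.Re z2.
Proof. by case: z1 z2 => [? ?] []. Qed.

Lemma ImD z1 z2 : complex.Im (z1 + z2) = complex.Im z1 + complex.Im z2.
Proof. by case: z1 z2 => [? ?] []. Qed.

Lemma Re_sum (I : Type) (r : seq I) (F : I -> R[i]) :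
  complex.Re (\sum_(i <- r) F i) = \sum_(i <- r) complex.Re (F i).
Proof. by apply: (big_morph (@complex.Re R) ReD). Qed.

Lemma Im_sum (I : Type) (r : seq I) (F : I -> R[i]) :
  complex.Im (\sum_(i <- r) F i) = \sum_(i <- r) complex.Im (F i).
Proof. by apply: (big_morph (@complex.Im R) ImD). Qed.

Lemma normcE z : `|z| = (Num.sqrt (complex.Re z ^+ 2 + complex.Im z ^+ 2))%:C%C.
Proof. by case: z. Qed.

Lemma Re_le_normc z : `|complex.Re z|%:C%C <= `|z|.
Proof.
rewrite normcE lecR -sqrtr_sqr ler_wsqrtr// lerDl sqr_ge0 //.
Qed.

Lemma Im_le_normc z : `|complex.Im z|%:C%C <= `|z|.
Proof.
by rewrite normcE lecR -sqrtr_sqr ler_wsqrtr// lerDr sqr_ge0.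
Qed.

Lemma cvg_complexP u z :
  ((u : nat -> R[i]^o) @ \oo --> (z : R[i]^o)) <->
  ((fun n => complex.Re (u n)) @ \oo --> complex.Re z) /\
  ((fun n => complex.Im (u n)) @ \oo --> complex.Im z).
Proof.
have ReB (a b : R[i]) : complex.Re (a - b) = complex.Re a - complex.Re b.
  by case: a b => [? ?] [].
have ImB (a b : R[i]) : complex.Im (a - b) = complex.Im a - complex.Im b.
  by case: a b => [? ?] [].
split.
  move=> /cvgrPdist_lt uz.
  split; apply/cvgrPdist_lt => e e0.
    have e0' : 0 < e%:C%C by rewrite ltcR.
    apply: filterS (uz _ e0') => n /= un.
    by rewrite -ltcR (le_lt_trans _ un)// -ReB; exact: Re_le_normc.
  have e0' : 0 < e%:C%C by rewrite ltcR.
  apply: filterS (uz _ e0') => n /= un.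
  by rewrite -ltcR (le_lt_trans _ un)// -ImB; exact: Im_le_normc.
move=> [/cvgrPdist_lt uR /cvgrPdist_lt uI]; apply/cvgrPdist_lt => -[e e'].
rewrite ltcE/= => /andP[/eqP -> e0].
have e20 : 0 < e / 2 by rewrite divr_gt0.
near=> n.
rewrite [X in `|X|](complexE (z - u n)) (le_lt_trans (ler_normD _ _))//.
have -> : (e +i* 0)%C = (e / 2)%:C%C + (e / 2)%:C%C :> R[i].
  by apply/eqP; rewrite eq_complex/= addr0 -splitr !eqxx.
apply: ltrD.
  rewrite normcE/= expr0n addr0 sqrtr_sqr ltcR ReB; near: n; exact: uR.
rewrite normrM (normcE 'i%C) /= expr0n/= expr1n add0r sqrtr1 mul1r.
rewrite normcE/= expr0n addr0 sqrtr_sqr ltcR ImB; near: n; exact: uI.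
Unshelve. all: by end_near. Qed.

End ComplexLimits.

Section ComplexMeasure.
Variable R : realType.
Local Notation T := (measurableTypeR R).

(* Functions on sets are total, so the values outside the Borel sigma-algebra
   are fixed to 0; two complex measures are then equal as soon as they agree
   on the Borel sets. *)
Definition complex_measure (f : set T -> R[i]) : Prop :=
  (forall E, ~ measurable E -> f E = 0) /\
  (forall F : nat -> set T, (forall k, measurable (F k)) -> trivIset setT F ->
    (fun n => \sum_(k < n) f (F k) : R[i]^o) @ \oo
      --> (f (\bigcup_k F k) : R[i]^o)).

Definition complex_measure_pred : {pred (set T -> R[i])} :=
  fun f => `[< complex_measure f >].

Lemma complex_measure_submod_closed : submod_closed complex_measure_pred.
Proof.
split=> [|c f g].
  apply/asboolP; split=> // F mF tF.
  rewrite (_ : (fun n => _) = fun=> 0); first exact: cvg_cst.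
  by apply/funext => n; rewrite big1.
move=> /asboolP[f0 fs] /asboolP[g0 gs]; apply/asboolP; split=> [E mE|F mF tF].
  by rewrite -[LHS]/(c * f E + g E) f0// g0// mulr0 addr0.
rewrite (_ : (fun n => _) =
    fun n => c * \sum_(k < n) f (F k) + \sum_(k < n) g (F k)); last first.
  by apply/funext => n; rewrite big_distrr/= -big_split.
apply: (@cvgD _ R[i]^o); last exact: gs.
by apply: (@cvgMl_tmp R[i]); exact: fs.
Qed.

HB.instance Definition _ := GRing.isSubmodClosed.Build R[i] (set T -> R[i])
  complex_measure_pred complex_measure_submod_closed.

Record cmeasure := CMeasure {
  cmeasure_fun :> set T -> R[i];
  cmeasure_funP : cmeasure_fun \in complex_measure_pred }.

HB.instance Definition _ := [isSub for cmeasure_fun].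
HB.instance Definition _ := [Choice of cmeasure by <:].
HB.instance Definition _ := [SubChoice_isSubLmodule of cmeasure by <:].

Implicit Types (mu nu : cmeasure).

Lemma cmeasureP mu : complex_measure mu.
Proof. by apply/asboolP/cmeasure_funP. Qed.

Lemma cmeasure_ext mu nu :
  (forall E, measurable E -> mu E = nu E) -> mu = nu.
Proof.
move=> mn; apply: val_inj; apply/funext => E /=.
have [/mn//|nE] := pselect (measurable E).
by rewrite (cmeasureP mu).1// (cmeasureP nu).1.
Qed.

Lemma cmeasureD mu nu E : (mu + nu) E = mu E + nu E. Proof. by []. Qed.

Lemma cmeasureN mu E : (- mu) E = - mu E. Proof. by []. Qed.

Lemma cmeasureZ c mu E : (c *: mu) E = c * mu E. Proof. by []. Qed.

Lemma cmeasure0 E : (0 : cmeasure) E = 0. Proof. by []. Qed.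

Lemma cmeasure_sum (I : Type) (r : seq I) (F : I -> cmeasure) E :
  (\sum_(i <- r) F i) E = \sum_(i <- r) F i E.
Proof. by apply: (big_morph (fun mu : cmeasure => mu E)). Qed.

Lemma cmeasure_set0 mu : mu set0 = 0.
Proof.
have [_ /(_ (fun=> set0))] := cmeasureP mu.
rewrite bigcup0// => /(_ (fun=> measurable0)) h; have {h} := h ltac:(by move=> i j _ _ []; rewrite setI0 => x).
under eq_fun do rewrite sumr_const card_ord.
move=> mu0.
apply/eqP/negPn/negP => mu_neq0.
have mu_gt0 : 0 < `|mu set0| by rewrite normr_gt0.
move/cvgrPdist_lt : mu0 => /(_ _ mu_gt0)[N _ /(_ (N + 2)%N (leq_addr _ _))] /=.
rewrite distrC addn2 mulrS [X in X - _]addrC addrK normrMn.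
by apply/negP; rewrite -real_leNgt ?num_real ?mulrS ?lerDl ?mulrn_wge0 ?ger0_real.
Qed.

End ComplexMeasure.

Section FiniteMeasures.
Variable R : realType.
Local Notation T := (measurableTypeR R).
Local Notation fmeas := {finite_measure set T -> \bar R}.
Implicit Types (a b c : fmeas) (mu nu : cmeasure R).

Section fadd.
Variables a b : fmeas.
Definition fadd := measure_add a b.
HB.instance Definition _ := Measure.on fadd.
Let fadd_fin : fin_num_fun fadd.
Proof. by move=> E mE; rewrite /fadd measure_addE fin_numD !fin_num_measure. Qed.
HB.instance Definition _ := Measure_isFinite.Build _ _ _ fadd fadd_fin.
End fadd.

Lemma faddE a b E : fadd a b E = (a E + b E)%E.
Proof. exact: measure_addE. Qed.

Definition fscale (r : {nonneg R}) a : fmeas := mscale r a.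

Definition cmeasure_of_fun a : set T -> R[i] :=
  fun E => if E \in measurable then (fine (a E))%:C%C else 0.

Lemma cmeasure_of_subproof a : cmeasure_of_fun a \in @complex_measure_pred R.
Proof.
apply/asboolP; split=> [E mE|F mF tF].
  by rewrite /cmeasure_of_fun; case: ifPn => //; rewrite inE.
have mUF : measurable (\bigcup_k F k) by exact: bigcup_measurable.
rewrite /cmeasure_of_fun mem_set//.
have aF : (fun n => \sum_(k < n) fine (a (F k))) @ \oo
    --> fine (a (\bigcup_k F k)).
  have := @measure_semi_sigma_additive _ _ _ a F mF tF mUF.
  rewrite -[X in _ --> X -> _]fineK ?fin_num_measure//.
  move=> /fine_cvgP[_]; rewrite (_ : _ \o _ = fun n => \sum_(k < n) fine (a (F k)))//.
  apply/funext => n /=; rewrite big_mkord sum_fine//.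
  by move=> i _; rewrite fin_num_measure.
apply/cvg_complexP; split.
  rewrite (_ : (fun n => _) = fun n => \sum_(k < n) fine (a (F k)))//.
  by apply/funext => n; rewrite Re_sum; apply: eq_bigr => i _; rewrite mem_set.
rewrite (_ : (fun n => _) = fun=> 0); first exact: cvg_cst.
by apply/funext => n; rewrite Im_sum big1// => i _; rewrite mem_set.
Qed.

Definition cmeasure_of a : cmeasure R := CMeasure (cmeasure_of_subproof a).

Lemma cmeasure_ofE a E : measurable E -> cmeasure_of a E = (fine (a E))%:C%C.
Proof. by move=> mE; rewrite /= /cmeasure_of_fun mem_set. Qed.

Section charges.
Variable mu : cmeasure R.

Definition re_charge : set T -> \bar R := fun E => (complex.Re (mu E))%:E.
Definition im_charge : set T -> \bar R := fun E => (complex.Im (mu E))%:E.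

Let re_charge0 : re_charge set0 = 0%E.
Proof. by rewrite /re_charge cmeasure_set0. Qed.

Let im_charge0 : im_charge set0 = 0%E.
Proof. by rewrite /im_charge cmeasure_set0. Qed.

Let re_charge_sigma : semi_sigma_additive re_charge.
Proof.
move=> F mF tF mUF; have /cvg_complexP[+ _] := (cmeasureP mu).2 F mF tF.
move=> muF; apply: cvg_EFin; first by apply: nearW => n; rewrite sumEFin.
rewrite (_ : _ \o _ = fun n => complex.Re (\sum_(k < n) mu (F k)))//.
by apply/funext => n /=; rewrite Re_sum sumEFin big_mkord.
Qed.

Let im_charge_sigma : semi_sigma_additive im_charge.
Proof.
move=> F mF tF mUF; have /cvg_complexP[_ +] := (cmeasureP mu).2 F mF tF.
move=> muF; apply: cvg_EFin; first by apply: nearW => n; rewrite sumEFin.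
rewrite (_ : _ \o _ = fun n => complex.Im (\sum_(k < n) mu (F k)))//.
by apply/funext => n /=; rewrite Im_sum sumEFin big_mkord.
Qed.

HB.instance Definition _ := isCharge.Build _ _ _ re_charge
  re_charge0 (fun _ _ => isT) re_charge_sigma.
HB.instance Definition _ := isCharge.Build _ _ _ im_charge
  im_charge0 (fun _ _ => isT) im_charge_sigma.

End charges.

Section jordan.
Variable nu : {charge set T -> \bar R}.

Definition pos_part : fmeas :=
  jordan_pos (projT2 (cid (projT2 (cid (Hahn_decomposition nu))))).
Definition neg_part : fmeas :=
  jordan_neg (projT2 (cid (projT2 (cid (Hahn_decomposition nu))))).

Lemma charge_parts E : measurable E ->
  fine (nu E) = fine (pos_part E) - fine (neg_part E).
Proof.
move=> mE.
rewrite (jordan_decomp (projT2 (cid (projT2 (cid (Hahn_decomposition nu))))) mE).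
rewrite /cadd/= cscaleN1 fineB//; exact: fin_num_measure.
Qed.

End jordan.

(* The four finite positive measures of the Jordan decomposition: mu equals
   part mu 0 + i part mu 1 - part mu 2 - i part mu 3. *)
Definition part mu (j : nat) : fmeas :=
  match j with
  | 0 => pos_part (re_charge mu)
  | 1 => pos_part (im_charge mu)
  | 2 => neg_part (re_charge mu)
  | _ => neg_part (im_charge mu)
  end.

End FiniteMeasures.

Section LinearExtension.
Variable R : realType.
Local Notation T := (measurableTypeR R).
Local Notation fmeas := {finite_measure set T -> \bar R}.
Implicit Types (a b c : fmeas) (mu nu : cmeasure R).

Lemma iX2 : 'i%C ^+ 2 = -1 :> R[i]. Proof. exact: sqr_i. Qed.

Lemma iX3 : 'i%C ^+ 3 = - 'i%C :> R[i].
Proof. by rewrite exprS iX2 mulrN1. Qed.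

Lemma isum (V : lmodType R[i]) (v : nat -> V) :
  \sum_(j < 4) 'i%C ^+ j *: v j =
  v 0%N - v 2%N + 'i%C *: (v 1%N - v 3%N).
Proof.
by rewrite !big_ord_recr big_ord0 /= add0r expr0 expr1 scale1r iX2 iX3 !scaleNr
  scale1r scalerBr addrACA -addrA.
Qed.

Lemma isumE (a : nat -> fmeas) E : measurable E ->
  (\sum_(j < 4) 'i%C ^+ j *: cmeasure_of (a j)) E =
  ((fine (a 0%N E) - fine (a 2%N E)) +i* (fine (a 1%N E) - fine (a 3%N E)))%C.
Proof.
move=> mE; rewrite (isum (fun j => cmeasure_of (a j))) !cmeasureD.
rewrite cmeasureZ !cmeasureD !cmeasureN !cmeasure_ofE//.
by apply/eqP; rewrite eq_complex/=; apply/andP; split; apply/eqP; ring.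
Qed.

Lemma cmeasure_parts mu :
  mu = \sum_(j < 4) 'i%C ^+ j *: cmeasure_of (part mu j).
Proof.
apply: cmeasure_ext => E mE; rewrite (isumE (part mu))//= -!charge_parts//.
by rewrite /re_charge /im_charge /=; case: (cmeasure_fun mu E).
Qed.

Definition flinear (V : lmodType R[i]) (Phi : fmeas -> V) : Prop :=
  [/\ forall a b, (forall E, measurable E -> a E = b E) -> Phi a = Phi b,
      forall a b, Phi (fadd a b) = Phi a + Phi b
    & forall r a, Phi (fscale r a) = r%:num%:C%C *: Phi a].

Lemma cmeasure_of_flinear : flinear (@cmeasure_of R).
Proof.
split=> [a b ab|a b|r a]; apply: cmeasure_ext => E mE.
- by rewrite !cmeasure_ofE// ab.
- rewrite cmeasureD !cmeasure_ofE// -rmorphD/=; congr (_%:C)%C.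
  by rewrite faddE fineD// fin_num_measure.
- rewrite cmeasureZ !cmeasure_ofE// -rmorphM/=; congr (_%:C)%C.
  by rewrite fineM// fin_num_measure.
Qed.

Definition lext (V : lmodType R[i]) (Phi : fmeas -> V) mu : V :=
  \sum_(j < 4) 'i%C ^+ j *: Phi (part mu j).

Section lext_theory.
Variables (V : lmodType R[i]) (Phi : fmeas -> V).
Hypothesis PhiP : flinear Phi.

Lemma flinear_uniq (a b : nat -> fmeas) :
  \sum_(j < 4) 'i%C ^+ j *: cmeasure_of (a j) =
  \sum_(j < 4) 'i%C ^+ j *: cmeasure_of (b j) ->
  \sum_(j < 4) 'i%C ^+ j *: Phi (a j) = \sum_(j < 4) 'i%C ^+ j *: Phi (b j).
Proof.
have [Pext Padd _] := PhiP.
move=> ab.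
have h E : measurable E ->
    (a 0%N E + b 2%N E = b 0%N E + a 2%N E)%E /\
    (a 1%N E + b 3%N E = b 1%N E + a 3%N E)%E.
  move=> mE; have := congr1 (fun m : cmeasure R => m E) ab.
  rewrite /= !isumE// => -[/eqP + /eqP].
  move=> h1 h2.
  have e (x y z t : R) : x - y == z - t -> x + t = z + y.
    by move=> /eqP h; apply/eqP; rewrite -subr_eq -addrA [t - y]addrC addrA h subrK.
  split; rewrite -[LHS]fineK ?fin_numD ?fin_num_measure//;
    rewrite -[RHS]fineK ?fin_numD ?fin_num_measure//;
    by rewrite !fineD ?fin_num_measure// (e _ _ _ _ h1, e _ _ _ _ h2).
have h1 : Phi (a 0%N) - Phi (a 2%N) = Phi (b 0%N) - Phi (b 2%N).
  apply/eqP; rewrite subr_eq addrAC eq_sym subr_eq eq_sym -!Padd; apply/eqP.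
  by apply: Pext => E /h[h1 _]; rewrite /= !faddE.
have h2 : Phi (a 1%N) - Phi (a 3%N) = Phi (b 1%N) - Phi (b 3%N).
  apply/eqP; rewrite subr_eq addrAC eq_sym subr_eq eq_sym -!Padd; apply/eqP.
  by apply: Pext => E /h[_ h2]; rewrite /= !faddE.
by rewrite (isum (fun j => Phi (a j))) (isum (fun j => Phi (b j))) h1 h2.
Qed.

End lext_theory.
End LinearExtension.

Section LinearExtensionTheory.
Variable R : realType.
Local Notation T := (measurableTypeR R).
Local Notation fmeas := {finite_measure set T -> \bar R}.
Implicit Types (a b c : fmeas) (mu nu : cmeasure R).

Lemma isumD (V : lmodType R[i]) (v w : nat -> V) :
  \sum_(j < 4) 'i%C ^+ j *: (v j + w j) =
  \sum_(j < 4) 'i%C ^+ j *: v j + \sum_(j < 4) 'i%C ^+ j *: w j.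
Proof. by rewrite -big_split; apply: eq_bigr => j _; rewrite scalerDr. Qed.

Lemma isumZ (V : lmodType R[i]) (v : nat -> V) x :
  \sum_(j < 4) 'i%C ^+ j *: (x *: v j) = x *: \sum_(j < 4) 'i%C ^+ j *: v j.
Proof.
by rewrite scaler_sumr; apply: eq_bigr => j _; rewrite !scalerA mulrC.
Qed.

Definition ishift (A : Type) (p : nat -> A) (j : nat) :=
  if j is j'.+1 then p j' else p 3%N.

Lemma isumi (V : lmodType R[i]) (v : nat -> V) :
  \sum_(j < 4) 'i%C ^+ j *: (ishift v j) =
  'i%C *: \sum_(j < 4) 'i%C ^+ j *: v j.
Proof.
rewrite (isum (ishift v)) (isum v) /= [RHS]scalerDr scalerA -expr2 iX2 scaleN1r opprB.
by rewrite addrC.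
Qed.

Variables (V : lmodType R[i]) (Phi : fmeas -> V).
Hypothesis PhiP : flinear Phi.

Let Padd a b : Phi (fadd a b) = Phi a + Phi b.
Proof. by case: PhiP. Qed.

Let Pscale r a : Phi (fscale r a) = r%:num%:C%C *: Phi a.
Proof. by case: PhiP. Qed.

Lemma lext_uniq (b : nat -> fmeas) mu :
  mu = \sum_(j < 4) 'i%C ^+ j *: cmeasure_of (b j) ->
  lext Phi mu = \sum_(j < 4) 'i%C ^+ j *: Phi (b j).
Proof. by move=> mub; apply: (flinear_uniq PhiP); rewrite -cmeasure_parts. Qed.

Lemma lextD mu nu : lext Phi (mu + nu) = lext Phi mu + lext Phi nu.
Proof.
rewrite (@lext_uniq (fun j => fadd (part mu j) (part nu j))).
  under eq_bigr do rewrite Padd.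
  exact: (isumD (fun j => Phi (part mu j)) (fun j => Phi (part nu j))).
have [_ ofD _] := cmeasure_of_flinear R.
under eq_bigr do rewrite ofD.
rewrite (isumD (fun j => cmeasure_of (part mu j))
  (fun j => cmeasure_of (part nu j))).
by rewrite -!cmeasure_parts.
Qed.

Lemma lextZi mu : lext Phi ('i%C *: mu) = 'i%C *: lext Phi mu.
Proof.
rewrite (@lext_uniq (ishift (part mu))).
  rewrite /lext -(isumi (fun j => Phi (part mu j))).
  by apply: eq_bigr => -[[|[|[|[|]]]]].
rewrite [in LHS](cmeasure_parts mu) -(isumi (fun j => cmeasure_of (part mu j))).
by apply: eq_bigr => -[[|[|[|[|]]]]].
Qed.

Lemma lextZ_nneg (r : {nonneg R}) mu :
  lext Phi (r%:num%:C%C *: mu) = r%:num%:C%C *: lext Phi mu.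
Proof.
rewrite (@lext_uniq (fun j => fscale r (part mu j))).
  under eq_bigr do rewrite Pscale.
  exact: (isumZ (fun j => Phi (part mu j))).
have [_ _ ofZ] := cmeasure_of_flinear R.
under eq_bigr do rewrite ofZ.
rewrite (isumZ (fun j => cmeasure_of (part mu j))).
by rewrite -!cmeasure_parts.
Qed.

Lemma lextZr (r : R) mu : lext Phi (r%:C%C *: mu) = r%:C%C *: lext Phi mu.
Proof.
have [r0|/ltW r0] := leP 0 r.
  exact: (lextZ_nneg (NngNum r0)).
rewrite -oppr_ge0 in r0.
have -> : r%:C%C = ('i%C * 'i%C) * (- r)%:C%C :> R[i].
  by rewrite -expr2 iX2 rmorphN mulN1r opprK.
rewrite -!scalerA !lextZi; congr (_ *: (_ *: _)).
exact: (lextZ_nneg (NngNum r0)).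
Qed.

Lemma lextZ (x : R[i]) mu : lext Phi (x *: mu) = x *: lext Phi mu.
Proof.
rewrite (complexE x) !scalerDl -!scalerA lextD lextZi !lextZr.
by [].
Qed.

Lemma cmeasure_ind (P : cmeasure R -> Prop) :
  (forall a, P (cmeasure_of a)) ->
  (forall mu nu, P mu -> P nu -> P (mu + nu)) ->
  (forall x mu, P mu -> P (x *: mu)) -> forall mu, P mu.
Proof.
move=> Pof PD PZ mu; rewrite (cmeasure_parts mu).
elim/big_ind : _ => //; last by move=> j _; exact/PZ/Pof.
by rewrite -(scale0r (cmeasure_of (part mu 0%N))); exact/PZ/Pof.
Qed.

Lemma lext_of a : lext Phi (cmeasure_of a) = Phi a.
Proof.
pose b (j : nat) := if j is 0%N then a else fscale (NngNum (lexx (0 : R))) a.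
rewrite (@lext_uniq b).
  by rewrite (isum (fun j => Phi (b j))) /b !Pscale !scale0r !subr0 scaler0 addr0.
have [_ _ ofZ] := cmeasure_of_flinear R.
rewrite (isum (fun j => cmeasure_of (b j))) /b !ofZ !scale0r !subr0.
by rewrite scaler0 addr0.
Qed.

End LinearExtensionTheory.

Section Convolution.
Variable R : realType.
Local Notation T := (measurableTypeR R).
Local Notation fmeas := {finite_measure set T -> \bar R}.
Implicit Types (a b c : fmeas) (mu nu rho : cmeasure R).

Definition addT (xy : T * T) : T := (xy.1 : R) + (xy.2 : R).

Lemma measurable_addT : measurable_fun setT addT.
Proof.
by apply: (@measurable_funD _ _ R setT (fst : T * T -> R) snd);
  [exact: measurable_fst|exact: measurable_snd].
Qed.

Lemma measurable_addT_pre (E : set T) : measurable E ->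
  measurable (addT @^-1` E).
Proof. by move=> mE; rewrite -[X in measurable X]setTI; exact: measurable_addT. Qed.

Section fconv.
Variables a b : fmeas.

Definition fconv : set T -> \bar R := pushforward (a \x b)%E addT.

Let fconv0 : fconv set0 = 0%E.
Proof. by rewrite /fconv /pushforward preimage_set0 measure0. Qed.

Let fconv_ge0 E : (0 <= fconv E)%E.
Proof. by apply: integral_ge0 => x _; exact: measure_ge0. Qed.

Let fconv_sigma_additive : semi_sigma_additive fconv.
Proof.
move=> F mF tF mUF; rewrite /fconv /pushforward preimage_bigcup.
apply: measure_semi_sigma_additive.
- by move=> n; exact: measurable_addT_pre.
- apply/trivIsetP => /= i j _ _ ij; rewrite -preimage_setI.
  by move/trivIsetP : tF => /(_ _ _ _ _ ij) ->//; rewrite preimage_set0.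
- by rewrite -preimage_bigcup; exact: measurable_addT_pre.
Qed.

HB.instance Definition _ := isMeasure.Build _ _ _ fconv
  fconv0 fconv_ge0 fconv_sigma_additive.

Let fconv_fin : fin_num_fun fconv.
Proof.
move=> E mE; rewrite ge0_fin_numE//.
apply: (@le_lt_trans _ _ ((a \x b)%E (setT `*` setT))).
  by rewrite /= /fconv /pushforward le_measure ?inE ?setXTT//; exact: measurable_addT_pre.
rewrite product_measure1E// lte_mul_pinfty//; first exact: fin_num_measure.
by rewrite -ge0_fin_numE//; exact: fin_num_measure.
Qed.

HB.instance Definition _ := Measure_isFinite.Build _ _ _ fconv fconv_fin.

End fconv.

Lemma fconvE a b E : fconv a b E = (\int[a]_x b [set y | E (addT (x, y))])%E.
Proof.
rewrite /fconv /pushforward /product_measure1; apply: eq_integral => x _ /=.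
by congr (b _); apply/seteqP; split => y /=; rewrite /xsection/= inE.
Qed.

Lemma measurable_shift (E : set T) (x : T) : measurable E ->
  measurable [set y : T | E (addT (x, y))].
Proof.
move=> mE; rewrite (_ : [set y | _] = xsection (addT @^-1` E) x).
  by apply: measurable_xsection; exact: measurable_addT_pre.
by apply/seteqP; split => y /=; rewrite /xsection/= inE.
Qed.

Lemma measurable_fun_shift a (E : set T) : measurable E ->
  measurable_fun setT (fun x : T => a [set y : T | E (addT (x, y))]).
Proof.
move=> mE; rewrite (_ : (fun x => _) = a \o xsection (addT @^-1` E)).
  by apply: measurable_fun_xsection; exact: measurable_addT_pre.
apply/funext => x /=; congr (a _).
by apply/seteqP; split => y /=; rewrite /xsection/= inE.
Qed.

Lemma fconvE_indic a b E : measurable E ->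
  fconv a b E = (\int[a]_x \int[b]_y (\1_E (addT (x, y)))%:E)%E.
Proof.
move=> mE; rewrite fconvE; apply: eq_integral => x _.
have mEx := measurable_shift x mE.
by rewrite -(setIT [set y | _]) -integral_indic//; exact: eq_integral.
Qed.

Lemma fconvC a b E : measurable E -> fconv a b E = fconv b a E.
Proof.
move=> mE; rewrite !fconvE_indic//.
rewrite (fubini_tonelli (fun xy => (\1_E (addT xy))%:E)) /=; last 2 first.
- apply/measurable_EFinP; apply: (measurableT_comp _ measurable_addT).
  exact: measurable_indic.
- by move=> x; rewrite lee_fin.
apply: eq_integral => y _; apply: eq_integral => x _.
by rewrite /addT/= addrC.
Qed.

Lemma fconv_flinear_r a : flinear (fun b => cmeasure_of (fconv a b)).
Proof.
have [ofext ofD ofZ] := cmeasure_of_flinear R.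
split=> [b c bc|b c|r b].
- apply: ofext => E mE; rewrite /= !fconvE; apply: eq_integral => x _.
  by apply: bc; exact: measurable_shift.
- rewrite -ofD; apply: ofext => E mE; rewrite /= faddE /= !fconvE.
  rewrite -ge0_integralD//; try exact: measurable_fun_shift.
  by apply: eq_integral => x _; rewrite /= faddE.
- rewrite -ofZ; apply: ofext => E mE; rewrite /= /mscale /= !fconvE.
  by rewrite -ge0_integralZl//; exact: measurable_fun_shift.
Qed.

Lemma fconv_flinear_l b : flinear (fun a => cmeasure_of (fconv a b)).
Proof.
rewrite (_ : (fun a => _) = fun a => cmeasure_of (fconv b a)).
  exact: fconv_flinear_r.
by apply/funext => a; apply: cmeasure_ext => E mE; rewrite !cmeasure_ofE//= fconvC.
Qed.

Lemma fconvA a b c E : measurable E ->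
  fconv a (fconv b c) E = fconv (fconv a b) c E.
Proof.
move=> mE; rewrite [LHS]fconvE [RHS]fconvE.
rewrite [RHS](ge0_integral_pushforward measurable_addT)//; last first.
  exact: measurable_fun_shift.
rewrite preimage_setT fubini_tonelli1//=; last first.
  by apply: measurableT_comp measurable_addT; exact: measurable_fun_shift.
apply: eq_integral => x _; rewrite fconvE; apply: eq_integral => y _ /=.
by congr (c _); apply/seteqP; split => z; rewrite /addT/= addrA.
Qed.

Definition fdirac : fmeas := dirac (0 : T).

Lemma fconv1 a E : measurable E -> fconv a fdirac E = a E.
Proof.
move=> mE; rewrite fconvE -[in RHS](setIT E) -integral_indic//.
apply: eq_integral => x _; rewrite /= diracE indicE; congr (_%:R%:E); congr (nat_of_bool _).
by apply/idP/idP; rewrite !inE /addT/= addr0.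
Qed.

End Convolution.

Section ConvolutionAlgebra.
Variable R : realType.
Local Notation T := (measurableTypeR R).
Local Notation fmeas := {finite_measure set T -> \bar R}.
Implicit Types (a b c : fmeas) (mu nu rho : cmeasure R).

(* The convolution (mu * nu)(E) = (mu x nu)({(x, y) | x + y \in E}), expanded
   along the Jordan decompositions of mu and nu. *)
Definition conv mu nu : cmeasure R :=
  \sum_(j < 4) \sum_(k < 4)
    'i%C ^+ (j + k) *: cmeasure_of (fconv (part mu j) (part nu k)).

Lemma conv_lext mu nu : conv mu nu =
  lext (fun a => lext (fun b => cmeasure_of (fconv a b)) nu) mu.
Proof.
rewrite /conv /lext; apply: eq_bigr => j _; rewrite scaler_sumr.
by apply: eq_bigr => k _; rewrite scalerA exprD.
Qed.

Lemma flinear_lext_fconv nu :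
  flinear (fun a => lext (fun b => cmeasure_of (fconv a b)) nu).
Proof.
rewrite /lext; split=> [a b ab|a b|r a].
- apply: eq_bigr => k _; congr (_ *: _).
  by have [h _ _] := fconv_flinear_l (part nu k); exact: h.
- rewrite -big_split/=; apply: eq_bigr => k _; rewrite -scalerDr; congr (_ *: _).
  by have [_ h _] := fconv_flinear_l (part nu k); exact: h.
- rewrite scaler_sumr; apply: eq_bigr => k _.
  rewrite [RHS]scalerA mulrC -scalerA; congr (_ *: _).
  by have [_ _ h] := fconv_flinear_l (part nu k); exact: h.
Qed.

Lemma conv_of a b :
  conv (cmeasure_of a) (cmeasure_of b) = cmeasure_of (fconv a b).
Proof.
rewrite conv_lext (lext_of (flinear_lext_fconv _)).
exact: (lext_of (fconv_flinear_r a)).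
Qed.

Lemma convC : commutative conv.
Proof.
move=> mu nu; rewrite /conv exchange_big; apply: eq_bigr => k _.
apply: eq_bigr => j _; rewrite addnC; congr (_ *: _).
by apply: cmeasure_ext => E mE; rewrite !cmeasure_ofE//= fconvC.
Qed.

Lemma convDl : left_distributive conv +%R.
Proof. by move=> mu nu rho; rewrite !conv_lext (lextD (flinear_lext_fconv _)). Qed.

Lemma convZl x mu nu : conv (x *: mu) nu = x *: conv mu nu.
Proof. by rewrite !conv_lext (lextZ (flinear_lext_fconv _)). Qed.

Lemma convDr : right_distributive conv +%R.
Proof. by move=> mu nu rho; rewrite convC convDl !(convC mu). Qed.

Lemma convZr x mu nu : conv mu (x *: nu) = x *: conv mu nu.
Proof. by rewrite convC convZl convC. Qed.

Lemma convA : associative conv.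
Proof.
move=> + nu rho; elim/cmeasure_ind => [a|mu mu' h h'|x mu h]; last 2 first.
- by rewrite !convDl h h'.
- by rewrite !convZl h.
move: nu; elim/cmeasure_ind => [b|mu mu' h h'|x mu h]; last 2 first.
- by rewrite !(convDr, convDl) h h'.
- by rewrite !(convZr, convZl) h.
move: rho; elim/cmeasure_ind => [c|mu mu' h h'|x mu h]; last 2 first.
- by rewrite !convDr h h'.
- by rewrite !convZr h.
rewrite !conv_of; apply: cmeasure_ext => E mE.
by rewrite !cmeasure_ofE//= fconvA.
Qed.

Definition cdirac : cmeasure R := cmeasure_of (fdirac R).

Lemma conv1l : left_id cdirac conv.
Proof.
move=> mu; rewrite convC; move: mu.
elim/cmeasure_ind => [a|mu nu h h'|x mu h]; last 2 first.
- by rewrite convDl h h'.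
- by rewrite convZl h.
rewrite conv_of; apply: cmeasure_ext => E mE.
by rewrite !cmeasure_ofE//= fconv1.
Qed.

Lemma cdirac_neq0 : cdirac != 0.
Proof.
apply/eqP => /(congr1 (fun mu : cmeasure R => mu setT)).
rewrite cmeasure_ofE// cmeasure0.
have -> : fdirac R setT = 1%E by rewrite /= diracT.
move=> -[].
by move/eqP; rewrite oner_eq0.
Qed.

HB.instance Definition _ := GRing.Zmodule_isComNzRing.Build (cmeasure R)
  convA convC conv1l convDl cdirac_neq0.

Let conv_scaleAl x mu nu : x *: (mu * nu) = (x *: mu) * nu.
Proof. exact/esym/convZl. Qed.

HB.instance Definition _ :=
  GRing.Lmodule_isLalgebra.Build R[i] (cmeasure R) conv_scaleAl.
HB.instance Definition _ :=
  GRing.Lalgebra_isComAlgebra.Build R[i] (cmeasure R).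

End ConvolutionAlgebra.

Section Damping.
Variable R : realType.
Local Notation T := (measurableTypeR R).
Local Notation fmeas := {finite_measure set T -> \bar R}.
Implicit Types (a : fmeas) (mu : cmeasure R) (t : R).

(* The weight is cut off on the negative half-line, where (1 - t)^x is
   unbounded; the measures of interest vanish there. *)
Definition damp_weight t (x : T) : R :=
  if (0 <= t < 1) && (0 <= (x : R)) then (1 - t) `^ x else 0.

Lemma damp_weight_ge0 t x : 0 <= damp_weight t x.
Proof. by rewrite /damp_weight; case: ifP => // _; exact: powR_ge0. Qed.

Lemma damp_weight_le1 t x : damp_weight t x <= 1.
Proof.
rewrite /damp_weight; case: ifP => // /andP[/andP[t0 t1] x0].
rewrite /powR subr_eq0 gt_eqF// -[leRHS]expR0 ler_expR mulr_ge0_le0// ln_le0//.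
by rewrite gerBl.
Qed.

Lemma measurable_damp_weight t : measurable_fun setT (damp_weight t).
Proof.
rewrite /damp_weight; case: (0 <= t < 1) => /=; last exact: measurable_cst.
apply: measurable_fun_ifT.
- by apply: (@measurable_fun_ler _ T R _ (cst 0) id).
- exact: (@measurable_powRr R (1 - t)).
- exact: measurable_cst.
Qed.

Section fdamp.
Variables (t : R) (a : fmeas).

Definition fdamp (E : set T) : \bar R := (\int[a]_(x in E) (damp_weight t x)%:E)%E.

Let fdamp0 : fdamp set0 = 0%E. Proof. exact: integral_set0. Qed.

Let fdamp_ge0 E : (0 <= fdamp E)%E.
Proof. by apply: integral_ge0 => x _; rewrite lee_fin damp_weight_ge0. Qed.

Let fdamp_sigma_additive : semi_sigma_additive fdamp.
Proof.
move=> F mF tF mUF; rewrite /fdamp ge0_integral_bigcup//; first last.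
- by move=> x _; rewrite lee_fin damp_weight_ge0.
- by apply/measurable_EFinP; exact: measurable_funTS (measurable_damp_weight t).
apply: is_cvg_ereal_nneg_natsum => k _.
by apply: integral_ge0 => x _; rewrite lee_fin damp_weight_ge0.
Qed.

HB.instance Definition _ := isMeasure.Build _ _ _ fdamp
  fdamp0 fdamp_ge0 fdamp_sigma_additive.

Let fdamp_fin : fin_num_fun fdamp.
Proof.
move=> E mE; rewrite ge0_fin_numE//.
apply: (@le_lt_trans _ _ (\int[a]_(x in E) (cst 1%E x))%E).
  apply: ge0_le_integral => //.
  - by move=> x _; rewrite lee_fin damp_weight_ge0.
  - by apply/measurable_EFinP; exact: measurable_funTS (measurable_damp_weight t).
  - by move=> x _; rewrite lee_fin damp_weight_le1.
by rewrite integral_cst// mul1e -ge0_fin_numE//; exact: fin_num_measure.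
Qed.

HB.instance Definition _ := Measure_isFinite.Build _ _ _ fdamp fdamp_fin.

Lemma fdampE (E : set T) : 0 <= t < 1 ->
  fdamp E = (\int[a]_(x in E `&` [set x : T | (0 <= (x : R))%R]) ((1 - t) `^ (x : R))%R%:E)%E.
Proof.
move=> t01; rewrite integral_mkcondr; apply: eq_integral => x _.
rewrite /damp_weight t01 /patch/=; have [x0|x0] := boolP (0 <= (x : R)).
  by rewrite mem_set.
by rewrite memNset//=; exact/negP.
Qed.

End fdamp.

(* The measure mu_t, for t in [0, 1]; see fdampE for the density. *)
Definition damp t mu : cmeasure R :=
  if t == 1 then mu [set 0] *: 1
  else \sum_(j < 4) 'i%C ^+ j *: cmeasure_of (fdamp t (part mu j)).

End Damping.

Section BanachSubalgebra.
Variable R : realType.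
Local Notation T := (measurableTypeR R).
Implicit Types (mu nu : cmeasure R) (E : set T) (A : set (cmeasure R)).

Definition measurable_partition E : set (nat -> set T) :=
  [set F | (forall k, measurable (F k)) /\ trivIset setT F /\
           \bigcup_k F k = E].

Definition total_variation mu E : \bar R :=
  ereal_sup [set (\sum_(0 <= k <oo) (ComplexField.Normc.normc (mu (F k)))%:E)%E |
    F in measurable_partition E].

Definition csupport mu : set R :=
  [set x | forall U : set R, open U -> U x -> total_variation mu U != 0%E].

Definition Mplus : set (cmeasure R) := [set mu | csupport mu `<=` `[0, +oo[].

Definition tv_norm mu : \bar R := total_variation mu `[0, +oo[%classic.

Definition subalgebra A : Prop :=
  [/\ A 1,
      forall mu nu, A mu -> A nu -> A (mu + nu),
      forall (x : R[i]) mu, A mu -> A (x *: mu)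
    & forall mu nu, A mu -> A nu -> A (mu * nu)].

Definition tv_closed_in_Mplus A : Prop :=
  forall mu, Mplus mu ->
    (forall e : R, 0 < e -> exists2 nu, A nu & (tv_norm (mu - nu)%R < e%:E)%E) ->
  A mu.

Definition banach_subalgebra A : Prop :=
  [/\ A `<=` Mplus, subalgebra A & tv_closed_in_Mplus A].

End BanachSubalgebra.

(* For a subring A of S, SL_n(A) is realized inside the matrices over S: the
   entries lie in A, and the determinant is the same in A and in S. *)
Section SpecialLinear.
Variables (S : comNzRingType) (A : set S) (n : nat).
Implicit Types (M N : 'M[S]_n) (H : set 'M[S]_n).

Definition SL : set 'M[S]_n :=
  [set M : 'M[S]_n | (forall i j, A (M i j)) /\ \det M = 1].

Definition elementary : set 'M[S]_n :=
  [set M : 'M[S]_n | exists i j (x : S),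
    [/\ i != j, A x & M = 1%:M + x *: delta_mx i j]].

Definition SL_subgroup H : Prop :=
  [/\ H `<=` SL,
      H 1%:M,
      (forall M N, H M -> H N -> H (M *m N))
    & forall M, H M -> exists2 N, H N & M *m N = 1%:M].

Definition EL : set 'M[S]_n := smallest SL_subgroup elementary.

End SpecialLinear.

Arguments SL {S} A n.
Arguments EL {S} A n.

(* Main.v *)
Require Import Defs.
From HB Require Import structures.
From mathcomp Require Import all_boot all_order all_algebra.
From mathcomp Require Import all_classical all_reals all_analysis.
From mathcomp Require Import perm measurable_realfun complex ring lra.

(* Let w_h be the density x |-> exp (- h x) on [0, +oo[. Since w_h is a
   character of the semigroup [0, +oo[, the map mu |-> w_h mu is a unital
   algebra morphism on the measures carried by [0, +oo[, so applied entrywise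
   to M in SL_n(A) it gives matrices M_h in SL_n(A), with M_0 = M. As h tends to
   infinity M_h tends to a matrix of scalars, which is a product of elementary
   matrices by Gaussian elimination. Two matrices X, Y in SL_n(A) that are close
   and such that adj Y is bounded satisfy X = (X adj Y) Y with X adj Y close to
   1; then Gaussian elimination works for X adj Y, the pivots being invertible
   in A by a Neumann series. Multiplication by a density bounded by 1 does not
   increase the norm, so adj M_h is bounded uniformly in h, and
   |M_(g + h) - M_g| <= |M_0 - M_h|: it is enough to move from infinity to 0 by
   finitely many equal steps, whose size is controlled at 0 by dominated
   convergence. *)

Set Implicit Arguments.
Unset Strict Implicit.
Unset Printing Implicit Defensive.

Import Order.TTheory GRing.Theory Num.Theory numFieldNormedType.Exports.

Local Open Scope classical_set_scope.
Local Open Scope ring_scope.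

(** * The elementary group over a subring *)

Section ElementaryGroup.
Variables (S : comNzRingType) (K : set S).

Definition subring : Prop :=
  [/\ K 1, forall x y, K x -> K y -> K (x - y)
    & forall x y, K x -> K y -> K (x * y)].

Hypothesis KP : subring.

Lemma subring1 : K 1. Proof. by case: KP. Qed.

Lemma subringM x y : K x -> K y -> K (x * y). Proof. by case: KP => _ _; apply. Qed.

Lemma subringB x y : K x -> K y -> K (x - y). Proof. by case: KP => _ + _; apply. Qed.

Lemma subring0 : K 0.
Proof. by rewrite -(subrr 1); apply: subringB; exact: subring1. Qed.

Lemma subringN x : K x -> K (- x).
Proof. by rewrite -sub0r; apply: subringB; exact: subring0. Qed.

Lemma subringD x y : K x -> K y -> K (x + y).
Proof. by rewrite -{2}(opprK y) => Kx /subringN; exact: subringB. Qed.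

Lemma subring_sum (I : Type) (r : seq I) (P : pred I) (F : I -> S) :
  (forall i, P i -> K (F i)) -> K (\sum_(i <- r | P i) F i).
Proof. by move=> KF; apply: big_ind => //; [exact: subring0|exact: subringD]. Qed.

Lemma subring_prod (I : Type) (r : seq I) (P : pred I) (F : I -> S) :
  (forall i, P i -> K (F i)) -> K (\prod_(i <- r | P i) F i).
Proof. by move=> KF; apply: big_ind => //; [exact: subring1|exact: subringM]. Qed.

Lemma subring_sign (b : bool) : K ((-1) ^+ b).
Proof. by case: b; [apply: subringN|]; exact: subring1. Qed.

Lemma subring_nat n : K n%:R.
Proof.
by elim: n => [|n ih]; [exact: subring0|rewrite -natr1; exact: subringD ih subring1].
Qed.

Lemma subring_det n (M : 'M[S]_n) : (forall i j, K (M i j)) -> K (\det M).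
Proof.
move=> KM; apply: subring_sum => s _; apply: subringM; first exact: subring_sign.
exact: subring_prod.
Qed.

Lemma subring_adj n (M : 'M[S]_n) :
  (forall i j, K (M i j)) -> forall i j, K ((\adj M) i j).
Proof.
move=> KM i j; rewrite mxE /cofactor -signr_odd.
apply: subringM; first exact: subring_sign.
by apply: subring_det => k l; rewrite !mxE.
Qed.

Lemma subring_mulmx m n p (M : 'M[S]_(m, n)) (N : 'M[S]_(n, p)) :
  (forall i j, K (M i j)) -> (forall i j, K (N i j)) ->
  forall i j, K ((M *m N) i j).
Proof.
by move=> KM KN i j; rewrite mxE; apply: subring_sum => k _; exact: subringM.
Qed.

(** Inverses are adjugates, whose entries are polynomials with integer coefficients in those of the
    matrix. *)
Lemma SL_subgroup_SL n : SL_subgroup K (@SL S K n).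
Proof.
split=> // [|M N [KM M1] [KN N1]|M [KM M1]].
- by split; [move=> i j; rewrite mxE; exact: subring_nat|exact: det1].
- by split; [exact: subring_mulmx|rewrite det_mulmx M1 N1 mulr1].
- exists (\adj M); last by rewrite mul_mx_adj M1.
  split; first exact: subring_adj.
  by have := congr1 determinant (mul_mx_adj M); rewrite det_mulmx M1 mul1r det1.
Qed.

Lemma elementary_sub_SL n : elementary K (n := n) `<=` SL K n.
Proof.
move=> _ [i [j [x [ij Kx ->]]]]; split=> [k l|].
  rewrite !mxE; apply: subringD; first exact: subring_nat.
  by apply: subringM => //; exact: subring_nat.
(* Up to transposition [i < j]; the transpose is then lower triangular with ones on the diagonal. *)
wlog ltij : i j ij / (i < j)%N => [wl|].
  have := ij; rewrite neq_lt => /orP[|ltji]; first exact: wl.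
  rewrite -det_tr linearD linearZ /= trmx1 trmx_delta; apply: wl => //.
  by rewrite eq_sym.
rewrite -det_tr det_trig.
  apply: big1 => k _; rewrite !mxE eqxx.
  have [->|_] := eqVneq k i; rewrite ?(negPf ij) /= ?andbF ?mulr0 ?addr0//.
apply/is_trig_mxP => k l kl; rewrite !mxE -val_eqE gtn_eqF// add0r.
have [li|_] := eqVneq l i; last by rewrite mulr0.
have [kj|_] := eqVneq k j; last by rewrite mulr0.
by move: ltij; rewrite -li -kj ltnNge ltnW.
Qed.

(** [EL] is an intersection of subgroups. The inverses that these provide for one matrix all
    coincide with its adjugate, so the intersection is stable under inverses. *)
Lemma EL_subgroup n : SL_subgroup K (EL K n).
Proof.
split=> [M|H [[]]//|M N EM EN H HH|M EM].
- by apply; split; [exact: SL_subgroup_SL|exact: elementary_sub_SL].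
- by have [[_ _ HM _] _] := HH; apply: HM; [exact: EM|exact: EN].
- have [KM M1] : SL K n M.
    by apply: EM; split; [exact: SL_subgroup_SL|exact: elementary_sub_SL].
  exists (\adj M); last by rewrite mul_mx_adj M1.
  move=> H HH; have [[_ _ _ /(_ M (EM _ HH))[N HN MN]] _] := HH.
  suff -> : \adj M = N by [].
  by rewrite -[LHS]mulmx1 -MN mulmxA mul_adj_mx M1 mul1mx.
Qed.

Lemma EL_SL n : EL K n `<=` SL K n. Proof. by have [] := EL_subgroup n. Qed.

Lemma EL1 n : EL K n 1%:M. Proof. by have [] := EL_subgroup n. Qed.

Lemma EL_mul n (M N : 'M[S]_n) : EL K n M -> EL K n N -> EL K n (M *m N).
Proof. by have [_ _ + _] := EL_subgroup n; apply. Qed.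

Lemma EL_elementary n (i j : 'I_n) x : i != j -> K x ->
  EL K n (1%:M + x *: delta_mx i j).
Proof. by move=> ij Kx H [_]; apply; exists i, j, x. Qed.

Lemma EL_mulKl n (E M : 'M[S]_n) : EL K n E -> EL K n (E *m M) -> EL K n M.
Proof.
move=> EE EM; have [_ _ _ /(_ E EE)[N EN EN1]] := EL_subgroup n.
by rewrite -[M]mul1mx -(mulmx1C EN1) -mulmxA; exact: EL_mul.
Qed.

Lemma EL_mulKr n (E M : 'M[S]_n) : EL K n E -> EL K n (M *m E) -> EL K n M.
Proof.
move=> EE EM; have [_ _ _ /(_ E EE)[N EN EN1]] := EL_subgroup n.
by rewrite -[M]mulmx1 -EN1 mulmxA; exact: EL_mul.
Qed.

Definition row_op n (i j : 'I_n) (x : S) (M : 'M[S]_n) : 'M[S]_n :=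
  (1%:M + x *: delta_mx i j) *m M.

Lemma row_opE n (i j : 'I_n) x (M : 'M[S]_n) k l :
  row_op i j x M k l = M k l + (if k == i then x * M j l else 0).
Proof.
rewrite /row_op mulmxDl mul1mx mxE -scalemxAl mxE; congr (_ + _).
rewrite mxE (bigD1 j)//= big1 ?addr0 => [|m mj]; rewrite !mxE.
  by rewrite eqxx andbT; case: (k == i); rewrite ?mul1r ?mul0r ?mulr0.
by rewrite (negPf mj) andbF mul0r.
Qed.

Lemma row_op_SL n (i j : 'I_n) x (M : 'M[S]_n) : i != j -> K x ->
  SL K n M -> SL K n (row_op i j x M).
Proof.
move=> ij Kx; have [_ _ SLM _] := SL_subgroup_SL n; apply: SLM.
by apply: EL_SL; exact: EL_elementary.
Qed.

Lemma row_op_EL n (i j : 'I_n) x (M : 'M[S]_n) : i != j -> K x ->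
  EL K n (row_op i j x M) -> EL K n M.
Proof. by move=> ij Kx; apply: EL_mulKl; exact: EL_elementary. Qed.

Lemma lift0_mx1 n : lift0_mx (1%:M : 'M[S]_n) = 1%:M.
Proof. by rewrite /lift0_mx -scalar_mx_block. Qed.

Lemma lift0_mxM n (M N : 'M[S]_n) : lift0_mx (M *m N) = lift0_mx M *m lift0_mx N.
Proof. by rewrite mulmx_block !mulmx1 !mulmx0 !mul0mx !addr0 add0r. Qed.

(** By minimality of [EL]: the matrices of [SL] whose bordered version lies in [EL] form a subgroup
    containing the elementary matrices. *)
Lemma EL_lift0 n (M : 'M[S]_n) : EL K n M -> EL K (1 + n) (lift0_mx M).
Proof.
pose H : set 'M[S]_n := [set N | SL K n N /\ EL K (1 + n) (lift0_mx N)].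
suff /smallest_sub sub : SL_subgroup K H.
  move=> EM; have [|//] := sub _ _ M EM.
  move=> _ [i [j [x [ij Kx ->]]]]; split.
    by apply: elementary_sub_SL; exists i, j, x.
  rewrite (_ : lift0_mx _ =
      1%:M + x *: delta_mx (rshift 1 i) (rshift 1 j)); first exact: EL_elementary.
  apply/matrixP => k l; case: (split_ordP k) => k' ->; case: (split_ordP l) => l' ->;
    rewrite !(block_mxEul, block_mxEur, block_mxEdl, block_mxEdr) !mxE;
    rewrite ?(eq_lrshift, eq_rlshift, eq_rshift, eq_lshift)/= ?mulr0 ?addr0 ?andbF//.
  by rewrite mulr0 addr0.
split=> [N []//||N P [SN EN] [SP EP]|N [SN EN]].
- split; first by have [] := SL_subgroup_SL n.
  by rewrite lift0_mx1; exact: EL1.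
- split; first by have [_ _ SLM _] := SL_subgroup_SL n; exact: SLM.
  by rewrite lift0_mxM; exact: EL_mul.
- have [_ _ _ /(_ N SN)[P SP NP]] := SL_subgroup_SL n.
  exists P => //; split => //.
  apply: (EL_mulKl EN); rewrite -lift0_mxM NP lift0_mx1; exact: EL1.
Qed.

(** Multiplying two such block matrices adds their columns [c], so the entries of [c] can be treated
    one at a time, each giving an elementary matrix. *)
Lemma EL_dlblock n (c : 'cV[S]_n) : (forall i, K (c i 0)) ->
  EL K (1 + n) (block_mx 1%:M 0 c 1%:M).
Proof.
move=> Kc; rewrite [c]matrix_sum_delta.
apply: (@big_ind _ (fun c => EL K (1 + n) (block_mx 1%:M 0 c 1%:M))).
- by rewrite -scalar_mx_block; exact: EL1.
- move=> x y Ex Ey; have := EL_mul Ex Ey.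
  by rewrite mulmx_block !mulmx1 !mul1mx !mulmx0 !mul0mx !addr0 add0r.
- move=> i _; rewrite big_ord_recl big_ord0 addr0.
  rewrite (_ : block_mx _ _ _ _ =
      1%:M + c i 0 *: delta_mx (rshift 1 i) (lshift n 0)); first exact: EL_elementary.
  apply/matrixP => k l; case: (split_ordP k) => k' ->; case: (split_ordP l) => l' ->;
    rewrite !(block_mxEul, block_mxEur, block_mxEdl, block_mxEdr) !mxE;
    rewrite ?(eq_lrshift, eq_rlshift, eq_rshift, eq_lshift)/= ?andbF ?mulr0;
    rewrite ?addr0 ?add0r//.
Qed.

Lemma EL_urblock n (r : 'rV[S]_n) : (forall i, K (r 0 i)) ->
  EL K (1 + n) (block_mx 1%:M r 0 1%:M).
Proof.
move=> Kr; rewrite [r]matrix_sum_delta big_ord_recl big_ord0 addr0.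
apply: (@big_ind _ (fun r => EL K (1 + n) (block_mx 1%:M r 0 1%:M))).
- by rewrite -scalar_mx_block; exact: EL1.
- move=> x y Ex Ey; have := EL_mul Ey Ex.
  by rewrite mulmx_block !mulmx1 !mul1mx !mulmx0 !mul0mx !addr0 !add0r.
- move=> i _.
  rewrite (_ : block_mx _ _ _ _ =
      1%:M + r 0 i *: delta_mx (lshift n 0) (rshift 1 i)); first exact: EL_elementary.
  apply/matrixP => k l; case: (split_ordP k) => k' ->; case: (split_ordP l) => l' ->;
    rewrite !(block_mxEul, block_mxEur, block_mxEdl, block_mxEdr) !mxE;
    rewrite ?(eq_lrshift, eq_rlshift, eq_rshift, eq_lshift)/= ?andbF ?mulr0;
    rewrite ?addr0 ?add0r//.
Qed.

End ElementaryGroup.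

(** By minimality again, through the subgroup of the matrices of [SL K n] that lie in [EL L n]. *)
Lemma EL_mono (S : comNzRingType) (K L : set S) n :
  subring K -> subring L -> K `<=` L -> EL K n `<=` EL L n.
Proof.
move=> KP LP KL; pose H : set 'M[S]_n := [set N | SL K n N /\ EL L n N].
suff /smallest_sub sub : SL_subgroup K H.
  move=> M EM; have [|//] := sub _ _ M EM.
  move=> _ [i [j [x [ij Kx ->]]]]; split.
    by apply: elementary_sub_SL => //; exists i, j, x.
  by apply: EL_elementary => //; exact: KL.
have [_ SL1 SLM SLV] := SL_subgroup_SL KP n.
split=> [N []//||N P [SN EN] [SP EP]|N [SN EN]].
- by split => //; exact: EL1.
- by split; [exact: SLM|exact: EL_mul].
- have [P SP NP] := SLV N SN; exists P => //; split => //.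
  by apply: (EL_mulKl LP EN); rewrite NP; exact: EL1.
Qed.

(** * Gaussian elimination *)

Section Elimination.
Variables (S : comNzRingType) (K : set S).
Hypothesis KP : subring K.

(** The Schur complement of the corner entry, in the form it takes when this entry is 1. *)
Definition pivot_compl n (M : 'M[S]_n.+2) : 'M[S]_n.+1 :=
  \matrix_(i, j) (M (lift 0 i) (lift 0 j) - M (lift 0 i) 0 * M 0 (lift 0 j)).

(** With corner 1, the left factor clears the first column and the right factor clears the first
    row. *)
Lemma pivot_factor n (M : 'M[S]_n.+2) : M 0 0 = 1 ->
  block_mx 1%:M 0 (- (\col_(i < n.+1) M (lift 0 i) 0)) 1%:M *m
    ((M : 'M[S]_(1 + n.+1)) *m
     block_mx 1%:M (- (\row_(j < n.+1) M 0 (lift 0 j))) 0 1%:M) =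
  lift0_mx (pivot_compl M).
Proof.
move=> M00; rewrite -{2}[M](@submxK _ 1 n.+1 1 n.+1).
have -> : ulsubmx (M : 'M[S]_(1 + n.+1)) = 1%:M.
  by apply/matrixP => i j; rewrite !ord1 !mxE !lshift0 M00.
have -> : ursubmx (M : 'M[S]_(1 + n.+1)) = \row_(j < n.+1) M 0 (lift 0 j).
  by apply/matrixP => i j; rewrite !ord1 !mxE !lshift0 rshift1.
have -> : dlsubmx (M : 'M[S]_(1 + n.+1)) = \col_(i < n.+1) M (lift 0 i) 0.
  by apply/matrixP => i j; rewrite !ord1 !mxE !lshift0 rshift1.
rewrite !mulmx_block !mulmx1 !mul1mx !mul0mx !mulmx0 !addr0 mulmx1 !addNr mulmx0.
rewrite add0r mulmxN addrC; congr block_mx.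
apply/matrixP => i j.
by rewrite !mxE big_ord_recl big_ord0 addr0 !mxE !rshift1.
Qed.

Lemma SL_pivot_compl n (M : 'M[S]_n.+2) : M 0 0 = 1 ->
  SL K n.+2 M -> SL K n.+1 (pivot_compl M).
Proof.
move=> M00 [KM M1]; split.
  by move=> i j; rewrite mxE; apply: (subringB KP) => //; apply: (subringM KP).
have := congr1 determinant (pivot_factor M00).
by rewrite !det_mulmx det_lblock !det_ublock M1 !det1 !mul1r => /esym.
Qed.

Lemma EL_pivot n (M : 'M[S]_n.+2) : M 0 0 = 1 -> SL K n.+2 M ->
  EL K n.+1 (pivot_compl M) -> EL K n.+2 M.
Proof.
move=> M00 [KM _] /(EL_lift0 KP); rewrite -(pivot_factor M00) => EM.
have {}EM := EL_mulKl KP (EL_dlblock KP _) EM.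
apply: (EL_mulKr KP (EL_urblock KP _)); last first.
  by apply: EM => i; rewrite !mxE; exact: subringN.
by move=> i; rewrite !mxE; exact: subringN.
Qed.

Lemma SL1_EL (M : 'M[S]_1) : SL K 1 M -> EL K 1 M.
Proof. by case=> _; rewrite (mx11_scalar M) det_scalar1 => ->; exact: EL1. Qed.

(** Induction on the size: row operations bring the corner to 1, then the Schur complement is
    smaller. *)
Theorem SL_EL_field n :
  (forall x, K x -> x != 0 -> exists2 y, K y & y * x = 1) ->
  SL K n.+1 `<=` EL K n.+1.
Proof.
move=> KV; elim: n => [|n IHn] M SM; first exact: SL1_EL.
(* A nonzero entry in the first column outside the corner suffices: adding [(1 - N 0 0) * y] times
   row [i] to row 0 makes the corner equal to 1. *)
have pivot (N : 'M[S]_n.+2) i :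
    i != 0 -> N i 0 != 0 -> SL K n.+2 N -> EL K n.+2 N.
  move=> i0 Ni0 SN; have [y Ky yN] := KV _ (SN.1 i 0) Ni0.
  have Kx : K ((1 - N 0 0) * y).
    apply: (subringM KP) => //.
    by apply: (subringB KP); [exact: subring1|exact: SN.1].
  rewrite eq_sym in i0; apply: (row_op_EL KP i0 Kx).
  have SN' := row_op_SL KP i0 Kx SN.
  have N'1 : row_op 0 i ((1 - N 0 0) * y) N 0 0 = 1.
    by rewrite row_opE eqxx -mulrA yN mulr1 addrC subrK.
  by apply: EL_pivot => //; apply: IHn; exact: SL_pivot_compl.
have [[i /andP[i0 Mi0]]|nM] := pselect (exists i, (i != 0) && (M i 0 != 0)).
  exact: (pivot _ _ i0 Mi0 SM).
have M0 i : i != 0 -> M i 0 = 0.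
  by move=> i0; apply: contra_notP nM => /eqP Mi0; exists i; rewrite i0.
(* Otherwise only the corner can be nonzero in the first column, and it is, the determinant being 1.
   A row operation then puts 1 below it, which reduces to the previous case. *)
have M00 : M 0 0 != 0.
  apply: contraTneq (oner_neq0 S) => M00.
  rewrite -SM.2 (expand_det_col _ 0) big1 ?eqxx// => i _.
  by have [->|/M0 ->] := eqVneq i 0; rewrite ?M00 mul0r.
have [y Ky yM] := KV _ (SM.1 0 0) M00.
have i0 : (lift 0 0 : 'I_n.+2) != 0 by [].
apply: (row_op_EL KP i0 Ky); apply: (pivot _ _ i0); last exact: row_op_SL.
by rewrite row_opE eqxx yM M0// add0r oner_neq0.
Qed.

(** * Elimination near the identity *)

Section near_identity.
Variables (R : realFieldType) (nrm : S -> R).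
Hypothesis nrm0 : nrm 0 = 0.
Hypothesis nrmN : forall x, nrm (- x) = nrm x.
Hypothesis nrmD : forall x y, nrm (x + y) <= nrm x + nrm y.
Hypothesis nrmM : forall x y, nrm (x * y) <= nrm x * nrm y.
Hypothesis nrm1 : nrm 1 <= 1.
(** The only place where completeness enters the elimination; in a Banach subalgebra the inverse is
    the sum of the Neumann series. *)
Hypothesis neumann : forall x, K x -> nrm (x - 1) <= 2^-1 ->
  exists2 y, K y /\ nrm y <= 2 & y * x = 1.

Let nrmB x y : nrm (x - y) <= nrm x + nrm y.
Proof. by rewrite -(nrmN y); exact: nrmD. Qed.

Let nrm_ge0 x : 0 <= nrm x.
Proof. by have := nrmB x x; rewrite subrr nrm0; lra. Qed.

Let nrmM_le x y a b : nrm x <= a -> nrm y <= b -> nrm (x * y) <= a * b.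
Proof. by move=> xa yb; apply: le_trans (nrmM _ _) _; exact: ler_pM. Qed.

(** Induction on the size through the Schur complement. Rows cannot be rescaled by elementary
    matrices, so the inverse of the corner serves only as a coefficient of row operations. *)
Theorem SL_EL_near1 n : exists2 e : R, 0 < e &
  forall M, SL K n.+1 M -> (forall i j, nrm (M i j - (i == j)%:R) <= e) ->
  EL K n.+1 M.
Proof.
elim: n => [|n [e e0 IHn]]; first by exists 1 => // M SM _; exact: SL1_EL.
(* The bound [2^-1] makes the corner invertible. In units of [d], the Schur complement differs from
   the identity by at most 1 + 4 + 1 + 7 = 13 in the row coming from [o1], and by at most 1 + 8 in
   the other rows. *)
exists (Num.min 2^-1 (e / 13)); first by rewrite lt_min invr_gt0 ltr0n divr_gt0.
set d := Num.min _ _ => M SM Md.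
have d2 : d <= 2^-1 by rewrite ge_min lexx.
have d13 : 13 * d <= e by rewrite mulrC -ler_pdivlMr// ge_min lexx orbT.
have {d2 d13}[d2 d13] : d <= 1 / 2 /\ 13 * d <= e by rewrite div1r.
clearbody d; have d0 : 0 <= d by apply: le_trans (Md 0 0).
have M00d : nrm (M 0 0 - 1) <= d by exact: (Md 0 0).
have [|y [Ky y2] yM] := neumann (SM.1 0 0); first by rewrite -div1r; lra.
pose o1 : 'I_n.+2 := lift 0 0; pose x := (1 - M o1 0) * y.
have Kx : K x.
  apply: (subringM KP) => //.
  by apply: (subringB KP); [exact: subring1|exact: SM.1].
have Mo1 : nrm (M o1 0) <= d by have := Md o1 0; rewrite subr0.
(* The first factor of [x] has norm at most [1 + d], hence at most 2, and the inverse [y] has norm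
   at most 2. *)
have x4 : nrm x <= 4.
  apply: (@le_trans _ _ (2 * 2)); last lra.
  by apply: nrmM_le => //; apply: le_trans (nrmB _ _) _; have := nrm1; lra.
have o10 : o1 != 0 by []. have o01 : 0 != o1 by [].
(* Two row operations turn the first column (u, c, ...) into (u, 1, ...), then
   (1, 1, ...), while keeping the Schur complement close to 1. *)
pose M1 := row_op o1 0 x M.
have SM1 : SL K n.+2 M1 by exact: row_op_SL.
have Ku : K (1 - M 0 0) by apply: (subringB KP); [exact: subring1|exact: SM.1].
have u_d : nrm (1 - M 0 0) <= d by rewrite -nrmN opprB.
pose M2 := row_op 0 o1 (1 - M 0 0) M1.
have SM2 : SL K n.+2 M2 by exact: row_op_SL.
have M1o1 j : M1 o1 j = M o1 j + x * M 0 j by rewrite row_opE eqxx.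
have M1E i j : i != o1 -> M1 i j = M i j.
  by move=> io1; rewrite row_opE (negPf io1) addr0.
have M20 j : M2 0 j = M 0 j + (1 - M 0 0) * M1 o1 j by rewrite row_opE eqxx M1E.
have M2E i j : i != 0 -> M2 i j = M1 i j.
  by move=> i0; rewrite row_opE (negPf i0) addr0.
have M1o10 : M1 o1 0 = 1 by rewrite M1o1 /x -mulrA yM mulr1 addrC subrK.
have M200 : M2 0 0 = 1 by rewrite M20 M1o10 mulr1 addrC subrK.
apply: (row_op_EL KP o10 Kx); apply: (row_op_EL KP o01 Ku).
apply: EL_pivot => //; apply: IHn; first exact: SL_pivot_compl.
move=> i j; rewrite mxE.
have M0j : nrm (M 0 (lift 0 j)) <= d by have := Md 0 (lift 0 j); rewrite subr0.
have M1j : nrm (M1 o1 (lift 0 j)) <= 7.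
  rewrite M1o1; apply: le_trans (nrmD _ _) _.
  have : nrm (x * M 0 (lift 0 j)) <= 4 * d by exact: nrmM_le.
  suff : nrm (M o1 (lift 0 j)) <= 1 + d by lra.
  rewrite -[M o1 _](subrK (o1 == lift 0 j)%:R); apply: le_trans (nrmD _ _) _.
  have := Md o1 (lift 0 j).
  suff : nrm (o1 == lift 0 j)%:R <= 1 by lra.
  by case: (_ == _) => //; rewrite nrm0.
have M2j : nrm (M2 0 (lift 0 j)) <= 8 * d.
  rewrite M20; apply: le_trans (nrmD _ _) _.
  have : nrm ((1 - M 0 0) * M1 o1 (lift 0 j)) <= d * 7 by exact: nrmM_le.
  by lra.
have Mij : nrm (M (lift 0 i) (lift 0 j) - (i == j)%:R) <= d.
  by have := Md (lift 0 i) (lift 0 j); rewrite (inj_eq lift_inj).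
rewrite M2E//; have [i1|i1] := eqVneq (lift 0 i) o1.
  rewrite M2E// i1 M1o10 mul1r M1o1 M20.
  rewrite i1 in Mij.
  (* The four terms have norms at most [d], [4 * d], [d] and [7 * d]. *)
  rewrite (_ : _ - _ = (M o1 (lift 0 j) - (i == j)%:R) + x * M 0 (lift 0 j)
    - M 0 (lift 0 j) - (1 - M 0 0) * M1 o1 (lift 0 j)); last by ring.
  apply: le_trans (nrmB _ _) _.
  have : nrm ((1 - M 0 0) * M1 o1 (lift 0 j)) <= d * 7 by exact: nrmM_le.
  have : nrm (x * M 0 (lift 0 j)) <= 4 * d by exact: nrmM_le.
  have := nrmB (M o1 (lift 0 j) - (i == j)%:R + x * M 0 (lift 0 j)) (M 0 (lift 0 j)).
  have := nrmD (M o1 (lift 0 j) - (i == j)%:R) (x * M 0 (lift 0 j)).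
  by lra.
rewrite M2E// !M1E//.
rewrite addrAC; apply: le_trans (nrmB _ _) _.
have : nrm (M (lift 0 i) 0 * M2 0 (lift 0 j)) <= 1 * (8 * d).
  by apply: nrmM_le => //; have := Md (lift 0 i) 0; rewrite subr0; lra.
by lra.
Qed.

Let nrm_sum (I : Type) (r : seq I) (F : I -> S) :
  nrm (\sum_(i <- r) F i) <= \sum_(i <- r) nrm (F i).
Proof.
elim/big_rec2 : _ => [|i x y _ le]; first by rewrite nrm0.
by apply: le_trans (nrmD _ _) _; rewrite lerD2l.
Qed.

Corollary SL_EL_close n (C : R) : 0 < C -> exists2 d : R, 0 < d &
  forall X Y, SL K n.+1 X -> SL K n.+1 Y ->
    (forall i j, nrm (X i j - Y i j) <= d) ->
    (forall i j, nrm ((\adj Y) i j) <= C) -> EL K n.+1 Y -> EL K n.+1 X.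
Proof.
move=> C0; have [e e0 near1] := SL_EL_near1 n.
(* Each entry of [(X - Y) *m \adj Y] is a sum of [n.+1] products of norm at most [d * C], which add
   up to [e]. *)
exists (e / (n.+1%:R * C)); first by rewrite divr_gt0// mulr_gt0.
set d := e / _ => X Y SX SY XY adjY EY.
rewrite -[X]mulmx1 -SY.2 -mul_adj_mx mulmxA; apply: (EL_mul KP _ EY).
apply: near1 => [|i j].
  have [_ _ SLmul _] := SL_subgroup_SL KP n.+1; apply: SLmul => //.
  split; first by apply: (subring_adj KP); exact: SY.1.
  by have := congr1 determinant (mul_mx_adj Y); rewrite det_mulmx SY.2 mul1r det1.
have -> : (X *m \adj Y) i j - (i == j)%:R = ((X - Y) *m \adj Y) i j.
  by rewrite mulmxBl mul_mx_adj SY.2 !mxE.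
rewrite mxE; apply: le_trans (nrm_sum _ _) _.
apply: (@le_trans _ _ (\sum_(k < n.+1) d * C)).
  by apply: ler_sum => k _; apply: nrmM_le => //; rewrite !mxE.
rewrite sumr_const card_ord -mulr_natl mulrCA /d divfK//.
by rewrite mulf_neq0// gt_eqF.
Qed.

End near_identity.
End Elimination.

(** * Densities *)

Section Density.
Variable R : realType.
Local Notation T := (measurableTypeR R).
Local Notation fmeas := {finite_measure set T -> \bar R}.
Implicit Types (a b : fmeas) (mu nu : cmeasure R).

(** The bound by 1 keeps measures with density finite and makes multiplication by a weight decrease
    the norm. *)
Record weight := Weight {
  weight_fun :> T -> R;
  weight_measurable : measurable_fun setT weight_fun;
  weight_bound : forall x, 0 <= weight_fun x <= 1 }.

Implicit Type w : weight.

Lemma weight_ge0 w x : 0 <= w x. Proof. by case/andP: (weight_bound w x). Qed.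

Lemma weight_le1 w x : w x <= 1. Proof. by case/andP: (weight_bound w x). Qed.

Lemma measurable_weightE w (E : set T) : measurable_fun E (fun x => (w x)%:E).
Proof. by apply/measurable_EFinP; exact: measurable_funTS (weight_measurable w). Qed.

Section fdens.
Variables (w : weight) (a : fmeas).

Definition fdens (E : set T) : \bar R := (\int[a]_(x in E) (w x)%:E)%E.

Let fdens0 : fdens set0 = 0%E. Proof. exact: integral_set0. Qed.

Let fdens_ge0 E : (0 <= fdens E)%E.
Proof. by apply: integral_ge0 => x _; rewrite lee_fin weight_ge0. Qed.

Let fdens_sigma_additive : semi_sigma_additive fdens.
Proof.
move=> F mF tF mUF; rewrite /fdens ge0_integral_bigcup//; first last.
- by move=> x _; rewrite lee_fin weight_ge0.
- exact: measurable_weightE.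
apply: is_cvg_ereal_nneg_natsum => k _.
by apply: integral_ge0 => x _; rewrite lee_fin weight_ge0.
Qed.

HB.instance Definition _ := isMeasure.Build _ _ _ fdens
  fdens0 fdens_ge0 fdens_sigma_additive.

Lemma fdens_le E : measurable E -> (fdens E <= a E)%E.
Proof.
move=> mE; rewrite -[leRHS]mul1e -integral_cst//.
apply: ge0_le_integral => //.
- by move=> x _; rewrite lee_fin weight_ge0.
- exact: measurable_weightE.
- by move=> x _; rewrite lee_fin weight_le1.
Qed.

Let fdens_fin : fin_num_fun fdens.
Proof.
move=> E mE; rewrite ge0_fin_numE//; apply: le_lt_trans (fdens_le mE) _.
by rewrite -ge0_fin_numE//; exact: fin_num_measure.
Qed.

HB.instance Definition _ := Measure_isFinite.Build _ _ _ fdens fdens_fin.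

(** Since [fdens] is dominated by [a], it has a Radon-Nikodym derivative, which equals [w] almost
    everywhere; the change of variables formula for that derivative gives the result. *)
Lemma integral_fdens (f : T -> \bar R) :
  (forall x, (0 <= f x)%E) -> measurable_fun setT f ->
  (\int[fdens]_x f x = \int[a]_x (f x * (w x)%:E))%E.
Proof.
move=> f0 mf.
have dom : (fdens : {measure set T -> \bar R}) `<< (a : {measure set T -> \bar R}).
  apply/null_content_dominatesP => E mE aE.
  by apply/eqP; rewrite eq_le measure_ge0 andbT -aE fdens_le.
rewrite -(Radon_Nikodym_SigmaFinite.change_of_variables dom)//.
apply: ae_eq_integral => //.
- apply: emeasurable_funM => //.
  exact: measurable_int (Radon_Nikodym_SigmaFinite.f_integrable dom).
- by apply: emeasurable_funM => //; exact: measurable_weightE.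
suff : ae_eq a setT (Radon_Nikodym_SigmaFinite.f (fdens) a) (EFin \o w).
  by apply: filterS => x /= + _ => ->.
apply: integral_ae_eq => //.
- exact: (Radon_Nikodym_SigmaFinite.f_integrable dom).
- exact: measurable_weightE.
- by move=> E _ mE; rewrite -Radon_Nikodym_SigmaFinite.f_integral.
Qed.

End fdens.

Lemma fdens_flinear w : flinear (fun a => cmeasure_of (fdens w a)).
Proof.
have [ofext ofD ofZ] := cmeasure_of_flinear R.
split=> [a b ab|a b|r a].
- apply: ofext => E mE; apply: eq_measure_integral => F mF _; exact: ab.
- rewrite -ofD; apply: ofext => E mE; rewrite /= faddE.
  apply: ge0_integral_measure_add => //; last exact: measurable_weightE.
  by move=> x _; rewrite lee_fin weight_ge0.
- rewrite -ofZ; apply: ofext => E mE.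
  by apply: (@ge0_integral_mscale _ T R a E mE r (EFin \o w));
    [exact: measurable_weightE|move=> x _; rewrite lee_fin weight_ge0].
Qed.

(** The complex measure of density [w] with respect to [mu], obtained from the positive case by
    linear extension. *)
Definition dens w mu := lext (fun a => cmeasure_of (fdens w a)) mu.

Lemma densD w mu nu : dens w (mu + nu) = dens w mu + dens w nu.
Proof. exact: (lextD (fdens_flinear w)). Qed.

Lemma densZ w x mu : dens w (x *: mu) = x *: dens w mu.
Proof. exact: (lextZ (fdens_flinear w)). Qed.

Lemma dens_of w a : dens w (cmeasure_of a) = cmeasure_of (fdens w a).
Proof. exact: (lext_of (fdens_flinear w)). Qed.

Lemma densN w mu : dens w (- mu) = - dens w mu.
Proof. by have := densZ w (-1) mu; rewrite !scaleN1r. Qed.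

Lemma dens0 w : dens w 0 = 0.
Proof. by have := densZ w 0 0; rewrite !scale0r. Qed.

Lemma dens_sum w (I : Type) (r : seq I) (P : pred I) (F : I -> cmeasure R) :
  dens w (\sum_(i <- r | P i) F i) = \sum_(i <- r | P i) dens w (F i).
Proof. exact: (big_morph _ (densD w) (dens0 w)). Qed.

(** By Tonelli both sides are double integrals of the indicator of [E] at [x + y], with weights
    [w0 x * w0 y * w (addT (x, y))] and [w x * w y]. *)
Lemma fdens_fconv (w0 w : weight) a b E :
  (forall x y, w0 x * w0 y * w (addT (x, y)) = w x * w y) ->
  measurable E ->
  fdens w (fconv (fdens w0 a) (fdens w0 b)) E = fconv (fdens w a) (fdens w b) E.
Proof.
move=> wM mE.
have mw0 := @measurable_weightE w0 setT; have mw := @measurable_weightE w setT.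
have w0ge x : (0 <= (w0 x)%:E)%E by rewrite lee_fin weight_ge0.
have wge x : (0 <= (w x)%:E)%E by rewrite lee_fin weight_ge0.
have m1E : measurable_fun setT (fun z : T => (\1_E z)%:E : \bar R).
  by apply/measurable_EFinP; exact: measurable_indic.
pose g (z : T) : \bar R := ((w z)%:E * (\1_E z)%:E)%E.
have mg : measurable_fun setT g by exact: emeasurable_funM.
have g0 z : (0 <= g z)%E by rewrite /g mule_ge0// lee_fin.
have sh (f : T -> \bar R) (x : T) : measurable_fun setT f ->
    measurable_fun setT (fun y : T => f (addT (x, y))).
  move=> mf; apply: (measurableT_comp mf).
  by apply: (@measurable_funD _ _ R setT (cst x) id).
have mint (f h : T -> \bar R) (c : fmeas) :
    (forall x, 0 <= f x)%E -> (forall x, 0 <= h x)%E ->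
    measurable_fun setT f -> measurable_fun setT h ->
    measurable_fun setT (fun x : T => \int[c]_y (f (addT (x, y)) * h y))%E.
  move=> f0 h0 mf mh.
  apply: (@measurable_fun_fubini_tonelli_F _ _ _ _ _ c
    (fun xy => f (addT xy) * h xy.2)%E).
  - apply: emeasurable_funM; first exact: measurableT_comp mf (@measurable_addT R).
    exact: measurableT_comp mh measurable_snd.
  - by move=> xy; rewrite mule_ge0.
have inner (v : weight) (f : T -> \bar R) (x : T) :
    (forall z, 0 <= f z)%E -> measurable_fun setT f ->
    (\int[fdens v b]_y f (addT (x, y)) =
     \int[b]_y (f (addT (x, y)) * (v y)%:E))%E.
  by move=> f0 mf; rewrite integral_fdens//; exact: sh.
have indic0 z : (0 <= (\1_E z)%:E :> \bar R)%E by rewrite lee_fin.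
(* Here [g] is [w] times the indicator of [E]. The pushforward by addition is unfolded first, then
   the densities [w0] of the two factors. *)
transitivity (\int[a]_x \int[b]_y (g (addT (x, y)) * (w0 x)%:E * (w0 y)%:E))%E.
  rewrite /fdens integral_mkcond.
  rewrite (_ : _ \_ _ = g); last first.
    apply/funext => z; rewrite /patch /g indicE.
    by case: (z \in E); rewrite ?mule1 ?mule0.
  rewrite (ge0_integral_pushforward (@measurable_addT R))// preimage_setT.
  rewrite fubini_tonelli1//=; last exact: measurableT_comp mg (@measurable_addT R).
  rewrite integral_fdens; last 2 first.
  - by move=> x; apply: integral_ge0 => y _; exact: g0.
  - by rewrite /fubini_F; under eq_fun do rewrite /= inner//; exact: mint.
  apply: eq_integral => x _; rewrite /fubini_F /= inner// -ge0_integralZr//.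
  - by apply: eq_integral => y _; rewrite muleAC.
  - by apply: emeasurable_funM => //; exact: sh.
  - by move=> y _; rewrite mule_ge0.
rewrite fconvE_indic// integral_fdens; last 2 first.
- by move=> x; apply: integral_ge0 => y _; rewrite lee_fin.
- under eq_fun do rewrite (inner w (fun z => (\1_E z)%:E)) //.
  exact: (mint (fun z => (\1_E z)%:E)).
apply: eq_integral => x _; rewrite (inner w (fun z => (\1_E z)%:E))//.
rewrite -ge0_integralZr//; last 2 first.
- by apply: emeasurable_funM => //; exact: (sh (fun z => (\1_E z)%:E)).
- by move=> y _; rewrite mule_ge0.
apply: eq_integral => y _; rewrite /g -!EFinM; congr EFin.
transitivity (w0 x * w0 y * w (addT (x, y)) * \1_E (addT (x, y))); first by ring.
by rewrite wM; ring.
Qed.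

Definition bilinear_cmeasure (B : cmeasure R -> cmeasure R -> cmeasure R) : Prop :=
  [/\ forall mu mu' nu, B (mu + mu') nu = B mu nu + B mu' nu,
      forall x mu nu, B (x *: mu) nu = x *: B mu nu,
      forall mu nu nu', B mu (nu + nu') = B mu nu + B mu nu'
    & forall x mu nu, B mu (x *: nu) = x *: B mu nu].

Lemma bilinear_cmeasure_ext (B C : cmeasure R -> cmeasure R -> cmeasure R) mu nu :
  bilinear_cmeasure B -> bilinear_cmeasure C ->
  (forall a b, B (cmeasure_of a) (cmeasure_of b) = C (cmeasure_of a) (cmeasure_of b)) ->
  B mu nu = C mu nu.
Proof.
move=> [BDl BZl BDr BZr] [CDl CZl CDr CZr] BC; move: mu.
elim/cmeasure_ind => [a|mu mu' h h'|x mu h]; last 2 first.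
- by rewrite BDl CDl h h'.
- by rewrite BZl CZl h.
by elim/cmeasure_ind : nu => [b|nu nu' h h'|x nu h]; rewrite ?BDr ?CDr ?BZr ?CZr ?h ?h'.
Qed.

(* With w0 the indicator of [0, +oo[ the hypothesis says that w is
   multiplicative there and vanishes elsewhere. *)
Lemma dens_conv (w0 w : weight) mu nu :
  (forall x y, w0 x * w0 y * w (addT (x, y)) = w x * w y) ->
  dens w (dens w0 mu * dens w0 nu) = dens w mu * dens w nu.
Proof.
move=> wM.
pose B (mu nu : cmeasure R) := dens w (Defs.conv (dens w0 mu) (dens w0 nu)).
pose C (mu nu : cmeasure R) := Defs.conv (dens w mu) (dens w nu).
have BP : bilinear_cmeasure B.
  split=> *; rewrite /B.
  - by rewrite (densD w0) convDl; exact: densD.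
  - by rewrite (densZ w0) convZl; exact: densZ.
  - by rewrite (densD w0) convDr; exact: densD.
  - by rewrite (densZ w0) convZr; exact: densZ.
have CP : bilinear_cmeasure C.
  split=> *; rewrite /C.
  - by rewrite densD convDl.
  - by rewrite densZ convZl.
  - by rewrite densD convDr.
  - by rewrite densZ convZr.
apply: (bilinear_cmeasure_ext mu nu BP CP) => a b.
rewrite /B /C !dens_of !conv_of dens_of.
apply: cmeasure_ext => E mE; rewrite !cmeasure_ofE//; congr ((fine _)%:C%C).
exact: (@fdens_fconv w0).
Qed.

End Density.

(** * The norm of the Jordan decomposition *)

Section JordanNorm.
Variable R : realType.
Local Notation T := (measurableTypeR R).
Local Notation fmeas := {finite_measure set T -> \bar R}.
Implicit Types (a b : fmeas) (mu nu : cmeasure R) (w : weight R).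

Lemma fine_measure_le a b E F : measurable E -> measurable F ->
  (a E <= b F)%E -> fine (a E) <= fine (b F).
Proof. by move=> mE mF ab; apply: fine_le => //; exact: fin_num_measure. Qed.

Lemma measure_fine_le a (E F : set T) : measurable E -> measurable F -> E `<=` F ->
  fine (a E) <= fine (a F).
Proof. by move=> mE mF EF; apply: fine_measure_le => //; rewrite le_measure ?inE. Qed.

(** The positive part of [E] is [nu (E & P)], writing [&] for intersection; it is at most
    [a (E & P)], hence at most [a E]. *)
Lemma jordan_pos_le (nu : {charge set T -> \bar R}) P N
    (nuPN : hahn_decomposition nu P N) a E : measurable E ->
  (forall F, measurable F -> (nu F <= a F)%E) -> (jordan_pos nuPN E <= a E)%E.
Proof.
move=> mE nua; have [[mP _] _ _ _] := nuPN.
rewrite jordan_posE cjordan_posE /crestr0 mem_set// /crestr.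
apply: le_trans (nua _ _) _; first exact: measurableI.
by rewrite le_measure ?inE//; exact: measurableI.
Qed.

Lemma jordan_neg_le (nu : {charge set T -> \bar R}) P N
    (nuPN : hahn_decomposition nu P N) a E : measurable E ->
  (forall F, measurable F -> (- nu F <= a F)%E) -> (jordan_neg nuPN E <= a E)%E.
Proof.
move=> mE nua; have [_ [mN _] _ _] := nuPN.
rewrite jordan_negE cjordan_negE /crestr0 mem_set// /crestr.
apply: le_trans (nua _ _) _; first exact: measurableI.
by rewrite le_measure ?inE//; exact: measurableI.
Qed.

(** The real part of [mu] is [b 0 - b 2], so it is at most [b 0] and its opposite at most [b 2] on
    every Borel set; the imaginary part is treated alike with [b 1] and [b 3]. *)
Lemma part_minimal mu (b : nat -> fmeas) (j : 'I_4) E :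
  mu = \sum_(j < 4) 'i%C ^+ j *: cmeasure_of (b j) -> measurable E ->
  (part mu j E <= b j E)%E.
Proof.
move=> mub mE.
have muE F : measurable F -> mu F =
    ((fine (b 0%N F) - fine (b 2%N F)) +i* (fine (b 1%N F) - fine (b 3%N F)))%C.
  by move=> mF; rewrite mub isumE.
have le_b i k F : measurable F -> ((fine (b i F) - fine (b k F))%:E <= b i F)%E.
  move=> mF; rewrite -[leRHS]fineK ?fin_num_measure// lee_fin lerBlDr lerDl.
  exact/fine_ge0/measure_ge0.
case: j => -[|[|[|[|//]]]] _ /=.
- by apply: jordan_pos_le => // F mF; rewrite /= /re_charge muE//=; exact: le_b.
- by apply: jordan_pos_le => // F mF; rewrite /= /im_charge muE//=; exact: le_b.
- by apply: jordan_neg_le => // F mF; rewrite /= /re_charge muE//= opprB; exact: le_b.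
- by apply: jordan_neg_le => // F mF; rewrite /= /im_charge muE//= opprB; exact: le_b.
Qed.

(* Equivalent to the total variation norm, but easily seen to be
   submultiplicative: it is minimal among the decompositions of mu. *)
Definition jordan_norm mu : R := \sum_(j < 4) fine (part mu j setT).

Lemma jordan_norm_le mu (b : nat -> fmeas) :
  mu = \sum_(j < 4) 'i%C ^+ j *: cmeasure_of (b j) ->
  jordan_norm mu <= \sum_(j < 4) fine (b j setT).
Proof.
move=> mub; apply: ler_sum => j _; apply: fine_measure_le => //.
exact: part_minimal.
Qed.

Lemma jordan_norm_ge0 mu : 0 <= jordan_norm mu.
Proof. by apply: sumr_ge0 => j _; exact/fine_ge0/measure_ge0. Qed.

Lemma jordan_norm_of a : jordan_norm (cmeasure_of a) <= fine (a setT).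
Proof.
pose b (j : nat) := if j is 0%N then a else fscale (NngNum (lexx (0 : R))) a.
have [_ _ ofZ] := cmeasure_of_flinear R.
apply: le_trans (jordan_norm_le (b := b) _) _.
  rewrite (isum (fun j => cmeasure_of (b j))) /b !ofZ !scale0r !subr0.
  by rewrite scaler0 addr0.
by rewrite !big_ord_recl big_ord0 /= /mscale /= !mul0e /= !addr0.
Qed.

(** Multiplication by ['i] permutes the four parts cyclically. *)
Lemma jordan_normZi mu : jordan_norm ('i%C *: mu) <= jordan_norm mu.
Proof.
apply: le_trans (jordan_norm_le (b := ishift (part mu)) _) _.
  rewrite [in LHS](cmeasure_parts mu) -(isumi (fun j => cmeasure_of (part mu j))).
  by apply: eq_bigr => -[[|[|[|[|]]]]].
by rewrite /jordan_norm !big_ord_recl !big_ord0 /=; lra.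
Qed.

Lemma jordan_normZiX n mu : jordan_norm ('i%C ^+ n *: mu) <= jordan_norm mu.
Proof.
elim: n => [|n ih]; first by rewrite expr0 scale1r.
by rewrite exprS -scalerA; exact: le_trans (jordan_normZi _) ih.
Qed.

Lemma jordan_normN mu : jordan_norm (- mu) = jordan_norm mu.
Proof.
have le nu : jordan_norm (- nu) <= jordan_norm nu.
  by rewrite -scaleN1r -iX2; exact: jordan_normZiX.
by apply/eqP; rewrite eq_le le -{1}(opprK mu) le.
Qed.

Lemma jordan_normD mu nu : jordan_norm (mu + nu) <= jordan_norm mu + jordan_norm nu.
Proof.
have [_ ofD _] := cmeasure_of_flinear R.
apply: le_trans (jordan_norm_le (b := fun j => fadd (part mu j) (part nu j)) _) _.
  under eq_bigr do rewrite ofD.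
  rewrite (isumD (fun j => cmeasure_of (part mu j)) (fun j => cmeasure_of (part nu j))).
  by rewrite -!cmeasure_parts.
rewrite -big_split ler_sum// => j _ /=.
by rewrite faddE fineD ?fin_num_measure.
Qed.

Lemma jordan_norm0 : jordan_norm 0 = 0.
Proof.
apply/eqP; rewrite eq_le jordan_norm_ge0 andbT.
have [_ _ /(_ (NngNum (lexx (0 : R))) (fdirac R))] := cmeasure_of_flinear R.
rewrite scale0r => <-; apply: le_trans (jordan_norm_of _) _.
by rewrite /= /mscale /= mul0r.
Qed.

Lemma jordan_norm1 : jordan_norm 1 <= 1.
Proof. by apply: le_trans (jordan_norm_of _) _; rewrite /= indicE in_setT. Qed.

Lemma jordan_norm_sum (I : Type) (r : seq I) (P : pred I) (F : I -> cmeasure R) :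
  jordan_norm (\sum_(i <- r | P i) F i) <= \sum_(i <- r | P i) jordan_norm (F i).
Proof.
elim/big_rec2 : _ => [|i x nu _ le]; first by rewrite jordan_norm0.
by apply: le_trans (jordan_normD _ _) _; rewrite lerD2l.
Qed.

Lemma fconvT a b : fconv a b setT = (a setT * b setT)%E.
Proof.
rewrite fconvE; transitivity (\int[a]_x (cst (b setT) x))%E.
  by apply: eq_integral => x _; congr (b _).
by rewrite integral_cst// muleC.
Qed.

(** Expanded over the pairs of parts, the product is a sum of powers of ['i] times convolutions of
    positive measures, whose total masses multiply. *)
Lemma jordan_normM mu nu : jordan_norm (mu * nu) <= jordan_norm mu * jordan_norm nu.
Proof.
rewrite [leLHS]/(jordan_norm (Defs.conv mu nu)) /Defs.conv /jordan_norm mulr_suml.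
apply: le_trans (jordan_norm_sum _ _ _) _; apply: ler_sum => j _.
apply: le_trans (jordan_norm_sum _ _ _) _; rewrite mulr_sumr; apply: ler_sum => k _.
apply: le_trans (jordan_normZiX _ _) _; apply: le_trans (jordan_norm_of _) _.
by rewrite /= [fconv _ _ _]fconvT fineM// fin_num_measure.
Qed.

Lemma jordan_norm_eq0 mu : jordan_norm mu = 0 -> mu = 0.
Proof.
move=> mu0; rewrite (cmeasure_parts mu) big1// => j _.
suff -> : cmeasure_of (part mu j) = 0 by rewrite scaler0.
apply: cmeasure_ext => E mE; rewrite cmeasure_ofE// cmeasure0.
have -> : fine (part mu j E) = 0; last by [].
apply/eqP; rewrite eq_le fine_ge0 ?measure_ge0// andbT.
have /eqP : \sum_(j < 4) fine (part mu j setT) = 0 by [].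
rewrite psumr_eq0 => [|k _]; last exact/fine_ge0/measure_ge0.
move=> /allP/(_ j (mem_index_enum _))/eqP <-.
exact: measure_fine_le.
Qed.

Lemma normc_ge0 (z : R[i]) : 0 <= ComplexField.Normc.normc z.
Proof. by case: z => x y; exact: sqrtr_ge0. Qed.

Lemma normc_le_parts mu E : measurable E ->
  ComplexField.Normc.normc (mu E) <= \sum_(j < 4) fine (part mu j E).
Proof.
move=> mE; rewrite [in leLHS](cmeasure_parts mu) isumE//.
have ge0 j : 0 <= fine (part mu j E) by exact/fine_ge0/measure_ge0.
rewrite !big_ord_recl big_ord0 /=.
have := (ge0 0%N, ge0 1%N, ge0 2%N, ge0 3%N) => -[[[]]].
move: (fine _) (fine _) (fine _) (fine _) => x z y t x0 y0 z0 t0.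
apply: (@le_trans _ _ (Num.sqrt ((x + y + z + t) ^+ 2))).
  by rewrite ler_wsqrtr//; nra.
by rewrite sqrtr_sqr ger0_norm; lra.
Qed.

(** A positive measure dominating the modulus of [mu] on each Borel set, hence also its total
    variation. *)
Definition part_sum mu : fmeas :=
  fadd (fadd (part mu 0) (part mu 1)) (fadd (part mu 2) (part mu 3)).

Lemma part_sumE mu E : measurable E ->
  part_sum mu E = (\sum_(j < 4) fine (part mu j E))%:E.
Proof.
move=> mE; rewrite /part_sum /= faddE /= !faddE !big_ord_recl big_ord0 addr0 /=.
by rewrite !EFinD !fineK ?fin_num_measure// !addeA.
Qed.

Lemma total_variation_le_jordan_norm mu E : measurable E ->
  (Defs.total_variation mu E <= (jordan_norm mu)%:E)%E.
Proof.
move=> mE; apply: ge_ereal_sup => _ [F [mF [tF FE]] <-].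
apply: (@le_trans _ _ (part_sum mu setT)); last by rewrite part_sumE.
apply: (@le_trans _ _ (part_sum mu E)); last by rewrite le_measure ?inE.
rewrite -FE measure_semi_bigcup//; last exact: bigcup_measurable.
apply: lee_nneseries => [k *|k *]; first by rewrite lee_fin normc_ge0.
suff : ((ComplexField.Normc.normc (mu (F k)))%:E <= part_sum mu (F k))%E by [].
by rewrite part_sumE// lee_fin; exact: normc_le_parts.
Qed.

Lemma normc_le_total_variation mu (E U : set T) :
  measurable E -> measurable U -> E `<=` U ->
  ((ComplexField.Normc.normc (mu E))%:E <= Defs.total_variation mu U)%E.
Proof.
move=> mE mU EU.
(* The partition of [U] into [E] and its complement in [U], continued by empty sets. *)
pose F := bigcup2 E (U `\` E).
have FP : measurable_partition U F.
  split; first by case=> [|[|k]] //=; [exact: measurableD|exact: measurable0].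
  split; last by rewrite bigcup2E setDUK.
  by rewrite -trivIset_bigcup2 setDIK.
apply: le_trans (ereal_sup_ubound _); last by exists F.
rewrite nneseries_recl//; last by move=> k; rewrite lee_fin normc_ge0.
by rewrite leeDl// nneseries_ge0// => k _ _; rewrite lee_fin normc_ge0.
Qed.

End JordanNorm.

(** * Exponential densities *)

Section Damping.
Variable R : realType.
Local Notation T := (measurableTypeR R).
Local Notation fmeas := {finite_measure set T -> \bar R}.
Implicit Types (a b : fmeas) (mu nu : cmeasure R) (w u : weight R).

(** The integral of [w] against [part_sum mu]. It bounds the norm of [dens w mu], is monotone in
    [w], and lends itself to dominated convergence. *)
Definition dens_norm w mu : R := \sum_(j < 4) fine (fdens w (part mu j) setT).

Lemma jordan_norm_dens w mu : jordan_norm (dens w mu) <= dens_norm w mu.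
Proof. exact: (@jordan_norm_le _ _ (fun j => fdens w (part mu j))). Qed.

Lemma dens_norm_le w mu : dens_norm w mu <= jordan_norm mu.
Proof.
by apply: ler_sum => j _; apply: fine_measure_le => //; exact: fdens_le.
Qed.

Lemma dens_norm_mono w u mu : (forall x, w x <= u x) -> dens_norm w mu <= dens_norm u mu.
Proof.
move=> wu; apply: ler_sum => j _; apply: fine_measure_le => //.
apply: ge0_le_integral => //.
- by move=> x _; rewrite lee_fin weight_ge0.
- exact: measurable_weightE.
- exact: measurable_weightE.
- by move=> x _; rewrite lee_fin.
Qed.

(** The cut-off at 0 makes this a weight for all [w] and [u]; it is the true difference where
    [u <= w]. *)
Definition weight_diff w u : weight R.
Proof.
exists (fun x => Num.max 0 (w x - u x)).
- by apply: measurable_maxr => //; apply: measurable_funB; exact: weight_measurable.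
- move=> x; rewrite le_max lexx /= ge_max ler01 /=.
  by have := weight_le1 w x; have := weight_ge0 u x; lra.
Defined.

Lemma weight_diffE w u x : u x <= w x -> weight_diff w u x = w x - u x.
Proof. by move=> ux; rewrite /weight_diff/= max_r// subr_ge0. Qed.

Lemma dens_diff w u mu : (forall x, u x <= w x) ->
  dens w mu - dens u mu = dens (weight_diff w u) mu.
Proof.
move=> uw; apply/eqP; rewrite subr_eq; apply/eqP.
rewrite /dens /lext -big_split; apply: eq_bigr => j _ /=; rewrite -scalerDr.
congr (_ *: _); have [_ ofD _] := cmeasure_of_flinear R; rewrite -ofD.
apply: cmeasure_ext => E mE; rewrite !cmeasure_ofE//; congr ((fine _)%:C%C).
rewrite /= faddE /= /fdens -ge0_integralD//.
- by apply: eq_integral => x _; rewrite -EFinD weight_diffE// subrK.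
- by move=> x _; rewrite lee_fin weight_ge0.
- exact: measurable_weightE.
- by move=> x _; rewrite lee_fin weight_ge0.
- exact: measurable_weightE.
Qed.

(** Dominated convergence for each of the four parts, the dominating function being the constant
    1. *)
Lemma dens_norm_cvg0 (u : nat -> weight R) mu :
  (forall x, u n x @[n --> \oo] --> (0 : R)) ->
  dens_norm (u n) mu @[n --> \oo] --> (0 : R).
Proof.
move=> u0.
have cv a : fine (fdens (u n) a setT) @[n --> \oo] --> (0 : R).
  apply: fine_cvg.
  rewrite -[X in _ --> X](@integral0 _ _ _ a setT).
  have [] := @dominated_convergence _ T R a setT measurableT
    (fun n x => (u n x)%:E) (cst 0%E) (cst 1%E) => //.
  - by move=> n; exact: measurable_weightE.
  - apply: aeW => x _; apply: cvg_EFin; first exact: nearW.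
    exact: u0.
  - by apply: finite_measure_integrable_cst.
  - apply: aeW => x n _ /=; rewrite lee_fin ger0_norm ?weight_le1//.
    exact: weight_ge0.
have := @cvg_big R^o _ +%R 0 xpredT (@add_continuous R^o) _ \oo (index_enum 'I_4)
  (fun j n => fine (fdens (u n) (part mu j) setT)) (fun=> 0) _ (fun j _ => cv _).
by rewrite big1_eq => h; exact: h.
Qed.

(** The form of membership in [Mplus] that is convenient for integration; [Mplus_vanishes] and
    [vanishes_Mplus] give the equivalence with the condition on the support. *)
Definition vanishes_neg mu : Prop :=
  forall E, measurable E -> E `<=` [set x : T | (x : R) < 0] -> mu E = 0.

(* The weight x |-> exp (- h x) on [0, +oo[, that is (1 - t)^x for t = 1 - exp (- h). *)
Definition decay_weight (h : R) : weight R :=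
  Weight (measurable_damp_weight (1 - expR (- h)))
    (fun x => introT andP (conj (damp_weight_ge0 _ x) (damp_weight_le1 _ x))).

Lemma decay_weightE h (x : R) : 0 <= h ->
  decay_weight h x = if 0 <= x then expR (- (h * x)) else 0.
Proof.
move=> h0; rewrite /= /damp_weight subr_ge0 -[leRHS]expR0 ler_expR oppr_le0 h0 /=.
by rewrite gtrBl expR_gt0 /= subKr /powR gt_eqF ?expR_gt0// expRK mulrN mulrC.
Qed.

Lemma damp_decay h mu : 0 <= h -> damp (1 - expR (- h)) mu = dens (decay_weight h) mu.
Proof.
move=> h0; have /negbTE t1 : 1 - expR (- h) != 1 by rewrite lt_eqF// gtrBl expR_gt0.
rewrite /damp t1; apply: eq_bigr => j _; congr (_ *: _).
by apply: cmeasure_ext => E mE; rewrite !cmeasure_ofE.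
Qed.

Lemma measurable_nonneg : measurable [set x : T | (0 <= (x : R))%R].
Proof. by rewrite -set_itvcy; exact: measurable_itv. Qed.

Lemma fdens_indic w (F : set T) a E : measurable F -> measurable E ->
  (forall x, w x = \1_F x) -> fdens w a E = a (F `&` E).
Proof.
by move=> mF mE wF; rewrite -integral_indic//; apply: eq_integral => x _; rewrite wF.
Qed.

Lemma cmeasureU mu E F : measurable E -> measurable F -> E `&` F = set0 ->
  mu (E `|` F) = mu E + mu F.
Proof.
move=> mE mF EF0; elim/cmeasure_ind : mu => [a|mu nu h h'|x mu h].
- have mEF : measurable (E `|` F) by exact: measurableU.
  rewrite !cmeasure_ofE// -rmorphD/=; congr (_%:C)%C.
  by rewrite measureU// fineD// fin_num_measure.
- by rewrite !cmeasureD h h' addrACA.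
- by rewrite !cmeasureZ h mulrDr.
Qed.

(** The weight with [h = 0] is the indicator of the half-line [N]. Splitting [E] along [N], the
    piece outside [N] is null for [mu]. *)
Lemma dens_decay0 mu : vanishes_neg mu -> dens (decay_weight 0) mu = mu.
Proof.
move=> mu0; apply: cmeasure_ext => E mE; have mN := measurable_nonneg.
set N := [set _ | _] in mN.
rewrite /dens /lext (isumE (fun j => fdens (decay_weight 0) (part mu j)))//.
have fE a : fdens (decay_weight 0) a E = a (N `&` E).
  apply: fdens_indic => // x; rewrite decay_weightE// mul0r oppr0 expR0 indicE.
  by case: ifPn => x0; [rewrite mem_set|rewrite memNset//; exact/negP].
have mNE : measurable (N `&` E) by exact: measurableI.
rewrite /= !fE -(isumE (part mu))// -cmeasure_parts.
rewrite -[in RHS](setUIDK E N) cmeasureU//.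
- rewrite setIC [X in _ + X]mu0 ?addr0//; first exact: measurableD.
  by move=> x [_ /negP]; rewrite -ltNge.
- exact: measurableI.
- exact: measurableD.
- by rewrite setDE setIACA setICr setI0.
Qed.

Lemma indic_bound (F : set T) x : 0 <= (\1_F x : R) <= 1.
Proof. by rewrite indicE ler0n lern1 leq_b1. Qed.

(** The pointwise limit of [decay_weight h] as [h] tends to infinity; it corresponds to the
    parameter [t = 1]. *)
Definition atom_weight : weight R :=
  Weight (measurable_indic (measurable_set1 (0 : R))) (indic_bound [set 0]).

Lemma dens_atom mu : dens atom_weight mu = mu [set 0] *: 1.
Proof.
elim/cmeasure_ind : mu => [a|mu nu h h'|x mu h]; last 2 first.
- by rewrite densD h h' cmeasureD scalerDl.
- by rewrite densZ h cmeasureZ scalerA.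
rewrite dens_of; apply: cmeasure_ext => E mE.
rewrite cmeasureZ !cmeasure_ofE// -rmorphM; congr (_%:C)%C.
rewrite /= (@fdens_indic _ [set 0])// indicE.
have [E0|E0] := boolP (0 \in E).
  by rewrite setIidl ?mulr1// => _ ->; rewrite -in_setE.
rewrite /= mulr0 (_ : _ `&` _ = set0) ?measure0//.
by apply/seteqP; split => // x [-> /mem_set]; rewrite (negPf E0).
Qed.

Lemma damp1 mu : damp 1 mu = dens atom_weight mu.
Proof. by rewrite /damp eqxx dens_atom. Qed.

End Damping.

(** * Multiplicative weights and their limits *)

Section MoreWeights.
Variable R : realType.
Local Notation T := (measurableTypeR R).
Local Notation fmeas := {finite_measure set T -> \bar R}.
Implicit Types (a b : fmeas) (mu nu : cmeasure R) (w u : weight R).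

(** Taking [y = 0] shows that [w] vanishes on the negative half-line. The normalization at 0 makes
    [dens w] preserve the unit. *)
Definition semicharacter w : Prop :=
  w 0 = 1 /\ forall x y : T,
    decay_weight 0 x * decay_weight 0 y * w (addT (x, y)) = w x * w y.

Lemma semicharacter_decay (h : R) : 0 <= h -> semicharacter (decay_weight h).
Proof.
move=> h0; split=> [|x y]; first by rewrite decay_weightE// lexx mulr0 oppr0 expR0.
rewrite !decay_weightE// /addT /= !mul0r oppr0 expR0.
case: ifPn => x0; last by rewrite !mul0r.
case: ifPn => y0; last by rewrite mulr0 mul0r mulr0.
by rewrite addr_ge0// !mul1r mulrDr opprD expRD.
Qed.

(** Two nonnegative numbers have sum 0 only if both are 0. *)
Lemma semicharacter_atom : semicharacter (atom_weight R).
Proof.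
split=> [|x y]; first by rewrite /= indicE mem_set.
rewrite !decay_weightE// /addT /= !mul0r oppr0 expR0 !indicE !classical_sets.in_set1.
case: ifPn => x0; last first.
  by rewrite !mul0r lt_eqF ?mul0r// ltNge.
case: ifPn => y0; last first.
  by rewrite mulr0 mul0r [y == 0]lt_eqF ?mulr0// ltNge.
by rewrite !mul1r paddr_eq0// -natrM mulnb.
Qed.

Lemma dens1 w : w 0 = 1 -> dens w 1 = 1.
Proof.
move=> w0; rewrite -[1]/(cdirac R) dens_of; apply: cmeasure_ext => E mE.
rewrite !cmeasure_ofE//; congr ((fine _)%:C%C).
rewrite /= /fdens integral_dirac//; last exact: measurable_weightE.
by rewrite w0 mule1.
Qed.

Lemma densM w mu nu : semicharacter w -> vanishes_neg mu -> vanishes_neg nu ->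
  dens w (mu * nu) = dens w mu * dens w nu.
Proof.
move=> [_ wM] mu0 nu0.
by rewrite -(dens_conv mu nu wM) !dens_decay0.
Qed.

(** [densM] gives multiplicativity for measures that vanish on the negative half-line, so the
    Leibniz formula is followed term by term, with all products kept in [K]. *)
Lemma dens_det w (K : set (cmeasure R)) n (M : 'M[cmeasure R]_n) :
  semicharacter w -> subring K -> K `<=` @vanishes_neg R ->
  (forall i j, K (M i j)) -> \det (map_mx (dens w) M) = dens w (\det M).
Proof.
move=> wP KP Kneg KM; rewrite /determinant dens_sum; apply: eq_bigr => /= s _.
have KMs i : K (M i (s i)) by [].
have Kprod : K (\prod_i M i (s i)) by exact: subring_prod.
rewrite densM//; last 2 first.
- by apply: Kneg; exact: subring_sign.
- exact: Kneg.
have -> : dens w ((-1) ^+ odd_perm s) = (-1) ^+ odd_perm s.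
  by case: (odd_perm s); rewrite ?expr1 ?expr0 ?densN dens1//; case: wP.
suff -> : \prod_i (map_mx (dens w) M) i (s i) = dens w (\prod_i M i (s i)) by [].
(* Membership in [K] is carried along the product so that [densM] applies at each factor. *)
pose P x y := K x /\ y = dens w x.
suff [] : P (\prod_i M i (s i)) (\prod_i (map_mx (dens w) M) i (s i)) by [].
apply: (@big_ind2 _ _ P) => [|x1 x2 y1 y2 [Kx1 ->] [Ky1 ->]|i _].
- by split; [exact: subring1|rewrite dens1//; case: wP].
- by split; [exact: (subringM KP)|rewrite densM//; exact: Kneg].
- by split => //; rewrite mxE.
Qed.

Lemma dens_adj w (K : set (cmeasure R)) n (M : 'M[cmeasure R]_n) :
  semicharacter w -> subring K -> K `<=` @vanishes_neg R ->
  (forall i j, K (M i j)) -> \adj (map_mx (dens w) M) = map_mx (dens w) (\adj M).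
Proof.
move=> wP KP Kneg KM; apply/matrixP => i j.
rewrite [LHS]mxE [RHS]mxE [X in dens w X]mxE /cofactor.
have -> : row' j (col' i (map_mx (dens w) M)) = map_mx (dens w) (row' j (col' i M)).
  by apply/matrixP => k l; rewrite !mxE.
rewrite (dens_det wP KP Kneg) => [|k l]; last by rewrite !mxE.
rewrite -signr_odd; case: (odd _); first by rewrite expr1 !mulN1r densN.
by rewrite expr0 !mul1r.
Qed.

Lemma decay_weight_anti (g h x : R) : 0 <= g -> g <= h ->
  decay_weight h x <= decay_weight g x.
Proof.
move=> g0 gh; rewrite !decay_weightE//; last exact: le_trans gh.
by case: ifPn => // x0; rewrite ler_expR lerN2 ler_wpM2r.
Qed.

Lemma atom_le_decay (h x : R) : 0 <= h -> atom_weight R x <= decay_weight h x.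
Proof.
move=> h0; rewrite decay_weightE// /= indicE classical_sets.in_set1.
have [->|_] := eqVneq x 0; first by rewrite lexx mulr0 oppr0 expR0.
by case: ifPn => // _; exact: expR_ge0.
Qed.

(** On the half-line the left-hand side is [expR (- (g * x))], at most 1, times the right-hand side.
    The bound is uniform in [g], so steps of equal length [h] are equally small. *)
Lemma decay_step (h g x : R) : 0 <= h -> 0 <= g ->
  decay_weight g x - decay_weight (g + h) x <=
  decay_weight 0 x - decay_weight h x.
Proof.
move=> h0 g0; rewrite !decay_weightE ?addr_ge0//.
case: ifPn => // x0; rewrite mul0r oppr0 expR0 mulrDl opprD expRD.
rewrite -[X in X - _]mulr1 -mulrBr ler_piMl//.
  by rewrite subr_ge0 -expR0 ler_expR oppr_le0 mulr_ge0.
by rewrite -expR0 ler_expR oppr_le0 mulr_ge0.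
Qed.

(** On the half-line the difference is 1 minus an exponential, at most [n.+1%:R^-1 * x] by
    convexity. *)
Lemma decay_weight_to0 (x : T) :
  weight_diff (decay_weight 0) (decay_weight n.+1%:R^-1) x @[n --> \oo] --> (0 : R).
Proof.
apply: (@squeeze_cvgr _ _ _ _ (cst 0) (fun n => n.+1%:R^-1 * `|x|)).
- apply: nearW => n; have n0 : 0 <= n.+1%:R^-1 :> R by rewrite invr_ge0.
  rewrite weight_ge0 weight_diffE ?decay_weight_anti// !decay_weightE// andTb.
  case: ifPn => x0; last by rewrite subrr mulr_ge0.
  rewrite mul0r oppr0 expR0 ger0_norm// lerBlDr -lerBlDl.
  exact: expR_ge1Dx.
- exact: cvg_cst.
- rewrite -[X in _ --> X](mul0r `|x|); apply: cvgM; last exact: cvg_cst.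
  exact: cvg_harmonic.
Qed.

(** At 0 the two weights agree; for [x > 0] the values are powers of [expR (- x)], which is less
    than 1. *)
Lemma decay_weight_to_atom (x : T) :
  weight_diff (decay_weight n%:R) (atom_weight R) x @[n --> \oo] --> (0 : R).
Proof.
rewrite (_ : (fun n => _) = fun n =>
    (if 0 <= (x : R) then expR (- (n%:R * x)) else 0) - (x == 0)%:R); last first.
  apply/funext => n; rewrite weight_diffE ?atom_le_decay// decay_weightE//.
  by rewrite /= indicE classical_sets.in_set1.
have [->|xn0] := eqVneq x 0.
  by under eq_fun do rewrite lexx mulr0 oppr0 expR0 subrr; exact: cvg_cst.
under eq_fun do rewrite subr0.
have [x0|x0] := leP (0:R) (x:R); last exact: cvg_cst.
under eq_fun do rewrite -mulrN expRM_natl.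
have ex1 : `|expR (- (x : R))| < 1.
  rewrite ger0_norm ?expR_ge0// -expR0 ltr_expR oppr_lt0.
  by rewrite lt_neqAle eq_sym xn0.
exact: (cvg_expr ex1).
Qed.

End MoreWeights.

(** * Completeness and supports *)

Section Series.
Variable R : realType.
Local Notation T := (measurableTypeR R).
Local Notation fmeas := {finite_measure set T -> \bar R}.
Implicit Types (mu nu : cmeasure R).

Lemma normc_le_jordan_norm mu E : measurable E ->
  ComplexField.Normc.normc (mu E) <= jordan_norm mu.
Proof.
move=> mE; apply: le_trans (normc_le_parts mu mE) _.
by apply: ler_sum => j _; exact: measure_fine_le.
Qed.

Lemma part_le_jordan_norm mu j : fine (part mu j setT) <= jordan_norm mu.
Proof.
have ge0 k : 0 <= fine (part mu k setT) by exact/fine_ge0/measure_ge0.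
have := (ge0 0%N, ge0 1%N, ge0 2%N, ge0 3%N) => -[[[]]].
rewrite /jordan_norm !big_ord_recr big_ord0 /=.
by case: j => [|[|[|j]]] /=; lra.
Qed.

Lemma geometric_half_sum (m n : nat) :
  \sum_(m <= k < n) 2^-1 ^+ k <= 2 * 2^-1 ^+ m :> R.
Proof.
have [mn|nm] := leqP m n; last first.
  by rewrite big_geq ?mulr_ge0// ?exprn_ge0 ?invr_ge0// ltnW.
rewrite (eq_bigr (fun k => - (2 * 2^-1 ^+ k.+1) - - (2 * 2^-1 ^+ k) : R)) => [|k _].
  rewrite telescope_sumr// opprK addrC gerBl mulr_ge0// exprn_ge0// invr_ge0//.
by rewrite exprS mulrA divff// mul1r; ring.
Qed.

Lemma le0_half_pow (x c : R) : (forall n, x <= c * 2^-1 ^+ n) -> x <= 0.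
Proof.
move=> xc; have half1 : `|2^-1 : R| < 1.
  by rewrite ger0_norm ?invr_ge0// invf_lt1// ltr1n.
apply: (cvgr_to_ge (@cvg_geometric R c 2^-1 half1)).
exact: nearW.
Qed.

(** * Sums of geometrically bounded series of measures *)

Section summable.
Variable mu : nat -> cmeasure R.
Hypothesis mu_le : forall k, jordan_norm (mu k) <= 2^-1 ^+ k.

(** Summing each part separately stays within positive measures, where a countable sum is a measure
    at once. *)
Definition tail_part (j n : nat) : set T -> \bar R :=
  mseries (fun k => part (mu k) j) n.

HB.instance Definition _ j n := Measure.on (tail_part j n).

Lemma tail_part_le j n : (tail_part j n setT <= (2 * 2^-1 ^+ n)%:E)%E.
Proof.
apply: lime_le; first exact: is_cvg_nneseries.
apply: nearW => m.
apply: (@le_trans _ _ (\sum_(n <= k < m) (2^-1 : R) ^+ k)%:E); last first.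
  by rewrite lee_fin; exact: geometric_half_sum.
rewrite -sumEFin; apply: lee_sum => k _.
rewrite -[leLHS]fineK ?fin_num_measure// lee_fin.
exact: le_trans (part_le_jordan_norm _ _) (mu_le k).
Qed.

Lemma tail_part_fin j n : fin_num_fun (tail_part j n).
Proof.
move=> E mE; rewrite ge0_fin_numE ?measure_ge0//.
apply: (@le_lt_trans _ _ (tail_part j n setT)); first by rewrite le_measure ?inE.
exact: le_lt_trans (tail_part_le _ _) (ltry _).
Qed.

HB.instance Definition _ j n :=
  Measure_isFinite.Build _ _ _ (tail_part j n) (@tail_part_fin j n).

(** The sum of the series from index [n] on, in norm, by [tail0E] and [jordan_norm_tail]. *)
Definition tail n : cmeasure R :=
  \sum_(j < 4) 'i%C ^+ j *: cmeasure_of (tail_part j n).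

Lemma tailS n : tail n = mu n + tail n.+1.
Proof.
rewrite [in RHS](cmeasure_parts (mu n)) /tail -big_split; apply: eq_bigr => j _ /=.
rewrite -scalerDr; congr (_ *: _).
have [_ ofD _] := cmeasure_of_flinear R; rewrite -ofD.
apply: cmeasure_ext => E mE; rewrite !cmeasure_ofE//; congr ((fine _)%:C%C).
rewrite /= faddE /= /tail_part /mseries (@nneseries_split _ _ n 1)//.
by rewrite addn1 big_nat1.
Qed.

Lemma tail0E n : tail 0 - \sum_(k < n) mu k = tail n.
Proof.
elim: n => [|n ih]; first by rewrite big_ord0 subr0.
by rewrite big_ord_recr /= opprD addrA ih tailS addrC addKr.
Qed.

(** Each of the four parts has mass at most [2 * 2^-1 ^+ n]. *)
Lemma jordan_norm_tail n : jordan_norm (tail n) <= 8 * 2^-1 ^+ n.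
Proof.
apply: le_trans (jordan_norm_le (b := fun j => tail_part j n) erefl) _.
have le2 j : fine (tail_part j n setT) <= 2 * 2^-1 ^+ n.
  by rewrite -lee_fin fineK ?fin_num_measure//; exact: tail_part_le.
have := (le2 0%N, le2 1%N, le2 2%N, le2 3%N) => -[[[]]].
by rewrite !big_ord_recr big_ord0 /=; lra.
Qed.

End summable.

(** Convergence in norm implies convergence on each Borel set. *)
Lemma vanishes_neg_lim mu (nu : nat -> cmeasure R) (c : R) :
  (forall n, jordan_norm (mu - nu n) <= c * 2^-1 ^+ n) ->
  (forall n, vanishes_neg (nu n)) -> vanishes_neg mu.
Proof.
move=> munu nu0 E mE En.
suff : ComplexField.Normc.normc (mu E) <= 0.
  move=> h; apply: ComplexField.Normc.eq0_normc; apply/eqP.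
  by rewrite eq_le h normc_ge0.
apply: (@le0_half_pow _ c) => n; apply: le_trans (munu n).
have -> : mu E = (mu - nu n) E by rewrite cmeasureD cmeasureN nu0// subr0.
exact: normc_le_jordan_norm.
Qed.

(* Every x < 0 lies in a rational interval on which mu is null, and there are
   only countably many such intervals. *)
Lemma Mplus_vanishes mu : Mplus mu -> vanishes_neg mu.
Proof.
move=> mup E mE En.
pose null (U : set T) := forall F, measurable F -> F `<=` U -> mu F = 0.
pose I (pq : rat * rat) : set T := `]ratr pq.1 : R, ratr pq.2[%classic.
(* An enumeration of the null rational intervals; every other index gives the empty set. *)
pose G k : set T := if unpickle k is Some pq then
  (if `[< null (I pq) >] then I pq else set0) else set0.
have mG k : measurable (G k).
  by rewrite /G; case: unpickle => // pq; case: ifP => // _; exact: measurable_itv.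
have Gnull k : null (G k).
  move=> F mF; rewrite /G; case: unpickle => [pq|]; last first.
    by rewrite subset0 => ->; exact: cmeasure_set0.
  case: ifPn => [/asboolP h /h -> //|_].
  by rewrite subset0 => ->; exact: cmeasure_set0.
have EG : E `<=` \bigcup_k G k.
  move=> x Ex; have x0 : (x : R) < 0 by exact: En.
  have [U [oU Ux tvU]] : exists U : set R,
      [/\ open U, U x & Defs.total_variation mu U = 0%E].
    apply: contrapT => noU.
    suff : csupport mu x by move=> /mup /=; rewrite in_itv /= andbT leNgt x0.
    by move=> U oU Ux; apply/eqP => tvU; apply: noU; exists U.
  have /nbhs_ballP[e /= e0 eU] : nbhs (x : R) U by exact: open_nbhs_nbhs.
  have [p] := @rat_in_itvoo R (x - e) x ltac:(by rewrite gtrBl).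
  rewrite in_itv /= => /andP[p1 p2].
  have [q] := @rat_in_itvoo R x (x + e) ltac:(by rewrite ltrDl).
  rewrite in_itv /= => /andP[q1 q2].
  have nI : null (I (p, q)).
    move=> F mF FI; apply: ComplexField.Normc.eq0_normc; apply/eqP.
    rewrite eq_le normc_ge0 andbT.
    suff : ((ComplexField.Normc.normc (mu F))%:E <= Defs.total_variation mu U)%E.
      by rewrite tvU lee_fin.
    apply: normc_le_total_variation => //; first exact: open_measurable.
    move=> y /FI; rewrite /I /= in_itv /= => /andP[py yq]; apply: eU.
    by rewrite /ball /= ltr_distlC; apply/andP; split; lra.
  have GI : G (pickle (p, q)) = I (p, q) by rewrite /G pickleK (asboolT nI).
  move: (pickle _) GI => k GI; exists k; first exact: Logic.I.
  by rewrite GI /I /= in_itv /= p2 q1.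
(* Disjoint pieces of [E], each inside a null set [G k]; countable additivity then gives
   [mu E = 0]. *)
pose D := seqDU (fun k => E `&` G k).
have mD k : measurable (D k).
  apply: measurableD; first exact: measurableI.
  by apply: bigsetU_measurable => i _; exact: measurableI.
have [_ /(_ D mD (trivIset_seqDU _))] := cmeasureP mu.
rewrite -seqDU_bigcup_eq -setI_bigcupr setIidl//.
rewrite (_ : (fun n => _) = fun=> 0).
  move=> h; apply/esym; apply: (cvg_unique _ _ h); last exact: cvg_cst.
  exact: (@norm_hausdorff R[i] R[i]^o).
apply/funext => n; apply: big1 => k _; apply: (Gnull k) => //.
by apply: subset_trans (@subset_seqDU _ _ _) _; exact: subIsetr.
Qed.

(** The open negative half-line is a neighbourhood of each [x < 0] and has total variation 0. *)
Lemma vanishes_Mplus mu : vanishes_neg mu -> Mplus mu.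
Proof.
move=> mu0 x xs; rewrite /= in_itv /= andbT leNgt; apply/negP => x0.
have := xs [set y : R | y < 0] (@open_lt _ 0) x0; apply/negP/negPn.
rewrite eq_le; apply/andP; split.
  apply: ge_ereal_sup => _ [F [mF [_ FE]] <-].
  rewrite eseries0// => k _ _; rewrite mu0//=.
    by rewrite /= !expr0n /= addr0 sqrtr0.
  by rewrite -FE; exact: bigcup_sup.
have mU : measurable ([set y : R | y < 0] : set T).
  exact: open_measurable (@open_lt _ 0).
apply: le_trans (normc_le_total_variation mu measurable0 mU (@sub0set _ _)).
by rewrite lee_fin; exact: normc_ge0.
Qed.

End Series.

(** * Banach subalgebras *)

Section BanachSubalgebraTheory.
Variables (R : realType) (A : set (cmeasure R)).
Hypothesis AP : banach_subalgebra A.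

Lemma banach_subring : subring A.
Proof.
have [_ [A1 AD AZ AM] _] := AP; split=> // x y Ax Ay.
by rewrite -scaleN1r; exact/AD/AZ.
Qed.

Lemma banach_vanishes : A `<=` @vanishes_neg R.
Proof. by move=> mu Amu; apply: Mplus_vanishes; have [+ _ _] := AP; apply. Qed.

Lemma jordan_normX (x : cmeasure R) k : jordan_norm x <= 2^-1 ->
  jordan_norm (x ^+ k) <= 2^-1 ^+ k.
Proof.
move=> x2; elim: k => [|k ih]; first by rewrite !expr0; exact: jordan_norm1.
rewrite !exprS; apply: le_trans (jordan_normM _ _) _.
by apply: ler_pM => //; exact: jordan_norm_ge0.
Qed.

(** The inverse is the sum [y] of the powers of [d = 1 - x]. *)
Lemma banach_neumann (x : cmeasure R) : A x -> jordan_norm (x - 1) <= 2^-1 ->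
  exists2 y, A y /\ jordan_norm y <= 2 & y * x = 1.
Proof.
move=> Ax x1; have AR := banach_subring.
pose d : cmeasure R := 1 - x.
have d2 : jordan_norm d <= 2^-1 by rewrite -jordan_normN opprB.
have Ad : A d by apply: (subringB AR) => //; exact: subring1.
have dX k := jordan_normX k d2.
pose y := tail dX 0; pose S n := \sum_(k < n) d ^+ k.
have yS n : jordan_norm (y - S n) <= 8 * 2^-1 ^+ n.
  by rewrite /y tail0E; exact: jordan_norm_tail.
have AX k : A (d ^+ k).
  elim: k => [|k ih]; first by rewrite expr0; exact: subring1.
  by rewrite exprS; exact: (subringM AR).
have AS n : A (S n) by apply: (subring_sum AR) => k _.
(* Closedness of [A] is relative to [Mplus], so the limit is first placed there. The total variation
   norm is then bounded by [jordan_norm]. *)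
have Ay : A y.
  have [_ _ Acl] := AP; apply: Acl.
    apply: vanishes_Mplus; apply: (vanishes_neg_lim yS) => n.
    exact: banach_vanishes.
  move=> e e0; apply: contrapT => noS.
  suff : e <= 0 by rewrite leNgt e0.
  apply: (@le0_half_pow _ _ 8) => n; rewrite leNgt; apply/negP => ne.
  apply: noS; exists (S n) => //.
  apply: (@le_lt_trans _ _ (jordan_norm (y - S n))%:E).
    by apply: total_variation_le_jordan_norm; exact: measurable_itv.
  by rewrite lte_fin; exact: le_lt_trans (yS n) ne.
have yx : y * x = 1.
  apply/eqP; rewrite -subr_eq0; apply/eqP/jordan_norm_eq0/eqP.
  rewrite eq_le jordan_norm_ge0 andbT.
  (* With the partial sum [S n], [y * x - 1] is [(y - S n) * x - d ^+ n]; the two terms account for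
     the two summands of the constant. *)
  apply: (@le0_half_pow _ _ (8 * jordan_norm x + 1)) => n.
  have Sx : S n * x = 1 - d ^+ n.
    have -> : x = 1 - d by rewrite /d opprB addrC subrK.
    by rewrite -opprB mulrN mulrC -subrX1 opprB.
  rewrite (_ : y * x - 1 = (y - S n) * x - d ^+ n); last first.
    by rewrite mulrBl Sx opprB addrA addrAC -addrA addrC; ring.
  apply: le_trans (jordan_normD _ _) _; rewrite jordan_normN.
  have : jordan_norm ((y - S n) * x) <= 8 * 2^-1 ^+ n * jordan_norm x.
    apply: le_trans (jordan_normM _ _) _.
    by apply: ler_wpM2r => //; exact: jordan_norm_ge0.
  by have := dX n; lra.
exists y => //; split=> //.
(* From [y = 1 + d * y]; the last term is absorbed to give the bound 2. *)
have : jordan_norm y <= 1 + 2^-1 * jordan_norm y.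
  have {1}-> : y = 1 + d * y by rewrite mulrBl mul1r [x * y]mulrC yx addrC subrK.
  apply: le_trans (jordan_normD _ _) _; apply: lerD; first exact: jordan_norm1.
  apply: le_trans (jordan_normM _ _) _.
  by apply: ler_wpM2r => //; exact: jordan_norm_ge0.
by lra.
Qed.

Lemma scalar_subring : subring [set x : cmeasure R | exists c : R[i], x = c *: 1].
Proof.
split=> [|_ _ [b ->] [c ->]|_ _ [b ->] [c ->]].
- by exists 1; rewrite scale1r.
- by exists (b - c); rewrite scalerBl.
- by exists (b * c); rewrite -scalerAl mul1r scalerA.
Qed.

(** The scalars form a copy of the field of complex numbers inside [A]: elimination takes place
    there and is transferred by [EL_mono]. *)
Lemma scalar_SL_EL n (M : 'M[cmeasure R]_n.+1) :
  (forall i j, exists c : R[i], M i j = c *: 1) -> \det M = 1 -> EL A n.+1 M.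
Proof.
move=> Mc M1; have [_ [A1 _ AZ _] _] := AP.
have /(_ M (conj Mc M1)) : SL [set x : cmeasure R | exists c : R[i], x = c *: 1] n.+1
    `<=` EL [set x : cmeasure R | exists c : R[i], x = c *: 1] n.+1.
  apply: (SL_EL_field scalar_subring) => _ [c ->] c0.
  exists (c^-1 *: 1); first by exists c^-1.
  rewrite -scalerAl mul1r scalerA mulVf ?scale1r//.
  by apply: contraNneq c0 => ->; rewrite scale0r.
apply: EL_mono => //; first exact: scalar_subring; first exact: banach_subring.
by move=> _ [c ->]; exact: AZ.
Qed.

End BanachSubalgebraTheory.

(** * Passage from infinite decay rate to rate zero *)

Theorem theorem2p3 (R : realType) (A : set (cmeasure R))
    (hA : banach_subalgebra A)
    (hdamp : forall (mu : cmeasure R) (t : R),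
       A mu -> 0 <= t <= 1 -> A (damp t mu))
    (n : nat) (hn : (0 < n)%N) :
  SL A n = EL A n.
Proof.
case: n hn => // n _.
have AR := banach_subring hA; have Aneg := banach_vanishes hA.
apply/seteqP; split; last exact: EL_SL.
move=> M SM; have [AM M1] := SM.
have Adecay (h : R) mu : 0 <= h -> A mu -> A (dens (decay_weight h) mu).
  move=> h0 Amu; rewrite -damp_decay//; apply: hdamp => //.
  by rewrite subr_ge0 -[leRHS]expR0 ler_expR oppr_le0 h0 gerBl expR_ge0.
have Aatom mu : A mu -> A (dens (atom_weight R) mu).
  by move=> Amu; rewrite -damp1; apply: hdamp => //; rewrite ler01 lexx.
pose adm w := semicharacter w /\ forall mu, A mu -> A (dens w mu).
have adm_decay h : 0 <= h -> adm (decay_weight h).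
  by move=> h0; split; [exact: semicharacter_decay|move=> mu; exact: Adecay].
have adm_atom : adm (atom_weight R) by split; [exact: semicharacter_atom|].
have SLw w : adm w -> SL A n.+1 (map_mx (dens w) M).
  move=> [wP Aw]; split=> [i j|]; first by rewrite mxE; exact: Aw.
  by rewrite (dens_det wP AR Aneg)// M1 dens1//; case: wP.
have adjw w i j : adm w -> (\adj (map_mx (dens w) M)) i j = dens w ((\adj M) i j).
  by move=> [wP _]; rewrite (dens_adj wP AR Aneg)// mxE.
(* A bound on the adjugates of all matrices [map_mx (dens w) M] at once, since weights decrease the
   norm; the summand 1 makes it positive. *)
pose C := 1 + \sum_i \sum_j jordan_norm ((\adj M) i j).
have C_ge k j : jordan_norm ((\adj M) k j) <= C.
  have ge0 := @jordan_norm_ge0 R.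
  apply: (@le_trans _ _ (\sum_j jordan_norm ((\adj M) k j))).
    by rewrite (bigD1 j)//= lerDl sumr_ge0.
  by rewrite /C [X in _ <= _ + X](bigD1 k)//= addrCA lerDl addr_ge0//
    sumr_ge0// => i _; rewrite sumr_ge0.
have C0 : 0 < C.
  rewrite /C ltr_pwDl// sumr_ge0// => i _; rewrite sumr_ge0// => j _.
  exact: jordan_norm_ge0.
have [d d0 close] := @SL_EL_close _ A AR R (@jordan_norm R) (@jordan_norm0 R)
  (@jordan_normN R) (@jordan_normD R) (@jordan_normM R) (@jordan_norm1 R)
  (@banach_neumann R A hA) n C C0.
have step w w' : adm w -> adm w' ->
    (forall i j, jordan_norm (dens w (M i j) - dens w' (M i j)) <= d) ->
    EL A n.+1 (map_mx (dens w') M) -> EL A n.+1 (map_mx (dens w) M).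
  move=> aw aw' dist; apply: close; [exact: SLw|exact: SLw| |] => i j.
    by rewrite !mxE.
  rewrite adjw//; apply: le_trans (C_ge i j).
  exact: le_trans (jordan_norm_dens _ _) (dens_norm_le _ _).
have dist (w w' v : weight R) : (forall x, w' x <= w x) ->
    (forall x, w x - w' x <= v x) ->
    (forall i j, dens_norm v (M i j) <= d) ->
    forall i j, jordan_norm (dens w (M i j) - dens w' (M i j)) <= d.
  move=> w'w wv vM i j; rewrite dens_diff//.
  apply: le_trans (jordan_norm_dens _ _) _; apply: le_trans (vM i j).
  by apply: dens_norm_mono => x; rewrite weight_diffE.
have small (u : nat -> weight R) : (forall x, u k x @[k --> \oo] --> (0 : R)) ->
    exists k, forall i j, dens_norm (u k) (M i j) <= d.
  move=> u0; have : \forall k \near \oo, forall i j, dens_norm (u k) (M i j) <= d.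
    apply: filter_forall => i; apply: filter_forall => j.
    have /cvgrPdist_le /(_ d d0) := dens_norm_cvg0 (M i j) u0.
    apply: filterS => k; rewrite sub0r normrN; exact: le_trans (ler_norm _).
  by move=> [N _ /(_ N (leqnn N))] h; exists N.
(* The index [m] fixes the step length [1 / (m + 1)], and [s] a rate at which the matrix is already
   within [d] of its limit. *)
have [m mP] := small _ (@decay_weight_to0 R).
have [s sP] := small _ (@decay_weight_to_atom R).
pose h : R := m.+1%:R^-1; have h0 : 0 <= h by rewrite invr_ge0.
(* Descent from rate [k * h] to 0, one step of length [h] at a time. *)
have chain k : EL A n.+1 (map_mx (dens (decay_weight (k%:R * h))) M) ->
    EL A n.+1 (map_mx (dens (decay_weight (0 : R))) M).
  elim: k => [|k ih]; first by rewrite mul0r.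
  rewrite -natr1 mulrDl mul1r => Ek; apply: ih.
  have kh0 : 0 <= k%:R * h by rewrite mulr_ge0.
  move: (k%:R * h) kh0 Ek => g g0 Eg.
  apply: step Eg; [exact: adm_decay|by apply: adm_decay; rewrite addr_ge0|].
  apply: dist mP => x; first by apply: decay_weight_anti => //; rewrite lerDl.
  by rewrite weight_diffE; [exact: decay_step|exact: decay_weight_anti].
have <- : map_mx (dens (decay_weight (0 : R))) M = M.
  by apply/matrixP => i j; rewrite mxE dens_decay0//; exact: Aneg.
apply: (chain (s * m.+1)%N).
(* The number of steps is chosen so that the descent starts exactly at rate [s]. *)
have -> : (s * m.+1)%:R * h = s%:R by rewrite natrM -mulrA divff ?mulr1// pnatr_eq0.
apply: (step _ _ (adm_decay _ (ler0n _ _)) adm_atom).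
  apply: dist sP => x; first exact: atom_le_decay.
  by rewrite weight_diffE// atom_le_decay.
(* At infinite rate only the masses at 0 remain, so the matrix is scalar entry by entry. *)
have [_ ?] := SLw _ adm_atom; apply: scalar_SL_EL => // i j.
by exists (M i j [set 0]); rewrite mxE dens_atom.
Qed.
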